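(* $\mathcal{P}^\perp=\ker\theta$. In particular, $\mathcal{P}$ is a sub-coalgebra of $(\mathcal{D},\downarrow)$, dual to the Stembridge peak algebra $\mathfrak{P}$, and $$[\Pi^P,K_Q]:=\begin{cases}1&\text{if }P=Q,\\0&\text{otherwise,}\end{cases}\qquad(P,Q\text{ peak sets in }\{1,\ldots,n\},\ n\in\mathbb{N}_0)$$ defines a pairing between $\mathcal{P}$ and $\mathfrak{P}$ such that $[\varphi,fg]=[\varphi\!\downarrow,\,f\otimes g]$ for all $\varphi\in\mathcal{P}$, $f,g\in\mathfrak{P}$.
   Context: $K$ is a field of characteristic $0$; $\mathbb{N}$ and $\mathbb{N}_0$ are the sets of positive and of nonnegative integers. Permutations act on the right ($i\pi$ is the image of $i$). For $\pi\in S_n$: $\mathrm{Des}(\pi)=\{i\mid 1\le i\le n-1,\ i\pi>(i+1)\pi\}$ and $\mathrm{Peak}(\pi)=\{i\mid 2\le i\le n-1,\ (i-1)\pi<i\pi>(i+1)\pi\}$. For $D\subseteq\{1,\ldots,n-1\}$ let $\Delta^D=\sum_{\mathrm{Des}(\pi)=D}\pi\in KS_n$ and $\Xi^D=\sum_{E\subseteq D}\Delta^E$; $\mathcal{D}_n$ is the linear span of the $\Delta^D$ and $\mathcal{D}=\bigoplus_{n\ge0}\mathcal{D}_n$. A composition of $n$ is a word $q=q_1.\cdots.q_k$ in the free monoid $\mathbb{N}^*$ over the alphabet $\mathbb{N}$ with $q_1+\cdots+q_k=n$; put $D(q)=\{q_1,q_1+q_2,\ldots,q_1+\cdots+q_{k-1}\}$,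 $\Delta^q=\Delta^{D(q)}$, $\Xi^q=\Xi^{D(q)}$. The Hopf algebra $(\mathcal{D},\star,\downarrow)$ has the product given by $\Xi^r\star\Xi^q=\Xi^{r.q}$ (concatenation of words) and the coproduct $\downarrow:\mathcal{D}\to\mathcal{D}\otimes\mathcal{D}$, the algebra homomorphism with $\Xi^n\!\downarrow=\sum_{k=0}^n\Xi^k\otimes\Xi^{n-k}$, where $\Xi^0$ is the empty permutation. For a set $D$ of integers and an integer $z$, $D+z=\{d+z\mid d\in D\}$. A peak set in $\{1,\ldots,n\}$ is a set $P\subseteq\{2,\ldots,n-1\}$ with $P\cap(P-1)=\emptyset$. Put $\Pi^P=\sum_{\mathrm{Peak}(\pi)=P}\pi$ (sum over $\pi\in S_n$); $\mathcal{P}_n$ is the linear span of all $\Pi^P$, $P$ a peak set in $\{1,\ldots,n\}$, and $\mathcal{P}=\bigoplus_{n\ge0}\mathcal{P}_n\subseteq\mathcal{D}$. $\mathsf{Qsym}$ is the algebra of quasi-symmetric functions over $K$ in commuting variables $x_1,x_2,\ldots$, with monomial basis $M_r=\sum_{i_1<\cdots<i_l}x_{i_1}^{r_1}\cdots x_{i_l}^{r_l}$ ($r=r_1.\cdots.r_l\in\mathbb{N}^*$) and fundamental basis $F_q=\sum_rM_r$, summed over all $r\in\mathbb{N}^*$ with the same sum as $q$ and $D(q)\subseteq D(r)$. For $D\subseteq\{1,\ldots,n-1\}$ write $F_D=F_q$, where $q$ is the composition of $n$ with $D=D(q)$ ($n$ being understood). The pairing between $\mathcal{D}$ and $\mathsf{Qsym}$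 is given by $\langle\Delta^q,F_s\rangle=1$ if $q=s$ and $0$ if $q\ne s$, and $\mathcal{P}^\perp:=\{f\in\mathsf{Qsym}\mid\langle\varphi,f\rangle=0\text{ for all }\varphi\in\mathcal{P}\}$. For a peak set $P$ in $\{1,\ldots,n\}$ put $$K_P:=\sum_{D\subseteq\{1,\ldots,n-1\},\ P\subseteq D\triangle(D+1)}F_D,$$ where $\triangle$ denotes symmetric difference. The Stembridge peak algebra $\mathfrak{P}$ is the sub-algebra of $\mathsf{Qsym}$ whose $n$-th homogeneous component $\mathfrak{P}_n$ has as linear basis the elements $K_P$, $P$ a peak set in $\{1,\ldots,n\}$. For $D\subseteq\{1,\ldots,n-1\}$ put $P(D)=D\cap\big((\{1,\ldots,n-1\}\setminus D)+1\big)$; $\theta:\mathsf{Qsym}\to\mathfrak{P}$ is the linear map defined by $F_D\mapsto K_{P(D)}$. Components of different degrees are orthogonal for $[\cdot,\cdot]$, and the pairing extends to tensor squares by $[\varphi\otimes\psi,f\otimes g]=[\varphi,f][\psi,g]$.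
   Formalization: K_P is taken with Stembridge's factor 2^(|P|+1) (factor 1 for n=0), missing in the printed definition; without it the identity [φ,fg]=[φ↓,f⊗g] fails already for φ=Π^∅ in degree 2, f=g=K_∅ in degree 1 (1 versus 2). *)

(* Defs.v *)
From mathcomp Require Import all_boot all_order all_algebra all_fingroup.
From mathcomp Require Import finmap.
From mathcomp.classical Require Import boolp classical_sets functions.
From mathcomp.classical Require Import cardinality fsbigop.
From mathcomp.multinomials Require Import monalg.
Set Implicit Arguments.
Unset Strict Implicit.
Unset Printing Implicit Defensive.
Import GRing.Theory.
Local Open Scope classical_set_scope.
Local Open Scope ring_scope.

(* Linear maps given by their values on a family [b], indexed by [A], which is
   a basis of its span; outside [span A b] the values are irrelevant. *)

Definition combines (K : fieldType) (I : choiceType) (V : lmodType K)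
    (A : set I) (b : I -> V) (v : V) (c : I -> K) : Prop :=
  [/\ finite_set [set i | c i != 0], [set i | c i != 0] `<=` A &
      v = \sum_(i \in A) c i *: b i].

Definition span (K : fieldType) (I : choiceType) (V : lmodType K)
    (A : set I) (b : I -> V) : set V :=
  [set v | exists c, combines A b v c].

Definition coord (K : fieldType) (I : choiceType) (V : lmodType K)
    (A : set I) (b : I -> V) (v : V) : I -> K :=
  xget (fun=> 0) [set c | combines A b v c].

Definition linext (K : fieldType) (I : choiceType) (V W : lmodType K)
    (A : set I) (b : I -> V) (w : I -> W) (v : V) : W :=
  \sum_(i \in A) coord A b v i *: w i.

Definition bilext (K : fieldType) (I J : choiceType) (V V' W : lmodType K)
    (A : set I) (b : I -> V) (B : set J) (b' : J -> V') (w : I -> J -> W)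
    (v : V) (v' : V') : W :=
  linext A b (fun i => linext B b' (w i) v') v.

(* All vectors are K-valued functions on a set X (formal, possibly infinite,
   linear combinations of elements of X); the tensor product of a space of
   functions on X and one on Y is realised in the functions on X * Y. *)
Definition tens (K : fieldType) (X Y : Type) (f : X -> K^o) (g : Y -> K^o) :
    X * Y -> K^o :=
  fun xy => f xy.1 * g xy.2.

(* Sets of integers *)

(* {a, ..., b} *)
Definition zint (a b : nat) : {fset nat} := [fset i in iota a (b.+1 - a)]%fset.

Definition shift1 (D : {fset nat}) : {fset nat} := [fset d.+1 | d in D]%fset.

Definition symdiff (A B : {fset nat}) : {fset nat} :=
  ((A `\` B) `|` (B `\` A))%fset.

(* Words over the positive integers *)
Definition compositions : set (seq nat) := [set q | all (leq 1) q].

Definition Dset (q : seq nat) : {fset nat} :=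
  [fset sumn (take i q) | i in iota 1 (size q).-1]%fset.

(* [P - 1] is computed with [predn]: elements of P are at least 2. *)
Definition peak_set (n : nat) (P : {fset nat}) : bool :=
  (P `<=` zint 2 n.-1)%fset && ((P `&` [fset d.-1 | d in P]) == fset0)%fset.

Definition peak_sets : set (nat * {fset nat}) := [set x | peak_set x.1 x.2].

(* Permutations and the descent algebra *)

(* Image of i for the action of 'S_n on {1, ..., n} *)
Definition img (n : nat) (s : 'S_n) (i : nat) : nat :=
  oapp (fun j : 'I_n => (s j).+1) 0%N (insub i.-1).

Definition Des (n : nat) (s : 'S_n) : {fset nat} :=
  [fset i in zint 1 n.-1 | (img s i.+1 < img s i)%N]%fset.

Definition Peak (n : nat) (s : 'S_n) : {fset nat} :=
  [fset i in zint 2 n.-1 |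
     (img s i.-1 < img s i)%N && (img s i.+1 < img s i)%N]%fset.

Definition perms : Type := {n : nat & 'S_n}.

Definition permvec (K : fieldType) (n : nat) (s : 'S_n) : perms -> K^o :=
  fun t => (t == Tagged (fun m : nat => 'S_m) s)%:R.

Definition Delta (K : fieldType) (n : nat) (D : {fset nat}) : perms -> K^o :=
  \sum_(s : 'S_n | Des s == D) permvec K s.

Definition Xi (K : fieldType) (n : nat) (D : {fset nat}) : perms -> K^o :=
  \sum_(E <- fpowerset D) Delta K n E.

Definition Deltaw (K : fieldType) (q : seq nat) : perms -> K^o :=
  Delta K (sumn q) (Dset q).

(* Note that [Xiw [:: 0]] is the empty permutation, i.e. [Xiw [::]]. *)
Definition Xiw (K : fieldType) (q : seq nat) : perms -> K^o :=
  Xi K (sumn q) (Dset q).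

Definition descent_algebra (K : fieldType) : set (perms -> K^o) :=
  span compositions (Deltaw K).
Arguments descent_algebra K : clear implicits.

Definition star (K : fieldType) : (perms -> K^o) -> (perms -> K^o) ->
    (perms -> K^o) :=
  bilext compositions (Xiw K) compositions (Xiw K) (fun r q => Xiw K (r ++ q)).

(* The product of the tensor square of the descent algebra *)
Definition star2 (K : fieldType) : (perms * perms -> K^o) ->
    (perms * perms -> K^o) -> (perms * perms -> K^o) :=
  let A := compositions `*` compositions in
  let b := fun x : seq nat * seq nat => tens (Xiw K x.1) (Xiw K x.2) in
  bilext A b A b (fun x y => tens (star (Xiw K x.1) (Xiw K y.1))
                                  (star (Xiw K x.2) (Xiw K y.2))).

(* The algebra homomorphism condition is used as a recursion on words:
   Xi^q is the star product of the Xi^k for k running through q. *)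
Definition coprod_Xiw (K : fieldType) (q : seq nat) : perms * perms -> K^o :=
  foldr (fun k t =>
           star2 (\sum_(j < k.+1) tens (Xiw K [:: j : nat]) (Xiw K [:: k - j]%N))
                 t)
        (tens (Xiw K [::]) (Xiw K [::])) q.

Definition coprod (K : fieldType) : (perms -> K^o) -> (perms * perms -> K^o) :=
  linext compositions (Xiw K) (coprod_Xiw K).

(* The peak algebra *)

Definition Pi (K : fieldType) (x : nat * {fset nat}) : perms -> K^o :=
  \sum_(s : 'S_x.1 | Peak s == x.2) permvec K s.

Definition peak_algebra (K : fieldType) : set (perms -> K^o) :=
  span peak_sets (Pi K).
Arguments peak_algebra K : clear implicits.

Definition peak_algebra2 (K : fieldType) : set (perms * perms -> K^o) :=
  span (peak_sets `*` peak_sets) (fun x => tens (Pi K x.1) (Pi K x.2)).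
Arguments peak_algebra2 K : clear implicits.

(* Quasi-symmetric functions, as formal power series in commuting variables
   indexed by nat, with the Cauchy product *)

Notation series K := ({cmonom nat} -> K^o).

Definition series_mul (K : fieldType) (f g : series K) : series K :=
  fun m => \sum_(p \in [set p : {cmonom nat} * {cmonom nat} |
                          mulcm p.1 p.2 = m]) f p.1 * g p.2.

Definition mon (i r : seq nat) : {cmonom nat} :=
  foldr (fun p m => mulcm (expcmn (ucm p.1) p.2) m) (onecm nat) (zip i r).

Definition Mon (K : fieldType) (r : seq nat) : series K :=
  fun m => \sum_(i \in [set i : seq nat |
                          [/\ size i = size r, sorted ltn i & mon i r = m]])
    (1 : K^o).

Definition Qsym (K : fieldType) : set (series K) := span compositions (Mon K).
Arguments Qsym K : clear implicits.

Definition Fund (K : fieldType) (n : nat) (D : {fset nat}) : series K :=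
  \sum_(r \in [set r | [/\ compositions r, sumn r = n & (D `<=` Dset r)%fset]])
    Mon K r.

Definition Fundw (K : fieldType) (q : seq nat) : series K :=
  Fund K (sumn q) (Dset q).

(* <Delta^q, F_s> = [q = s] *)
Definition dpair (K : fieldType) (phi : perms -> K^o) (f : series K) : K :=
  bilext compositions (Deltaw K) compositions (Fundw K)
    (fun q s => (q == s)%:R : K^o) phi f.

Definition peak_perp (K : fieldType) : set (series K) :=
  [set f | Qsym K f /\ forall phi, peak_algebra K phi -> dpair phi f = 0].
Arguments peak_perp K : clear implicits.

(* The factor is Stembridge's normalisation of the basis of his algebra (with
   value 1 at the unit, in degree 0).  It cannot be omitted: the sums
   L_n = \sum_D F_D, for n = 1, 2 and P the empty set, satisfy L_1 L_1 = L_2,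
   whereas the component of Pi^set0 = Xi^(1.1) (in degree 2) of bidegree (1, 1)
   under the coproduct is 2 (Xi^1 (x) Xi^1). *)
Definition stembridge_factor (n : nat) (P : {fset nat}) : nat :=
  if n == 0%N then 1%N else (2 ^ (size P).+1)%N.

Definition Kst (K : fieldType) (x : nat * {fset nat}) : series K :=
  (stembridge_factor x.1 x.2)%:R *:
  \sum_(D <- fpowerset (zint 1 x.1.-1) | (x.2 `<=` symdiff D (shift1 D))%fset)
    Fund K x.1 D.

Definition stembridge_algebra (K : fieldType) : set (series K) :=
  span peak_sets (Kst K).
Arguments stembridge_algebra K : clear implicits.

Definition peak_part (n : nat) (D : {fset nat}) : {fset nat} :=
  (D `&` shift1 (zint 1 n.-1 `\` D))%fset.

Definition theta (K : fieldType) : series K -> series K :=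
  linext compositions (Fundw K)
    (fun q => Kst K (sumn q, peak_part (sumn q) (Dset q))).

Definition ker_theta (K : fieldType) : set (series K) :=
  [set f | Qsym K f /\ theta f = 0].
Arguments ker_theta K : clear implicits.

(* [Pi^P, K_Q] = [P = Q]; an index consists of a degree and a peak set, so that
   components of different degrees are orthogonal. *)
Definition ppair (K : fieldType) (phi : perms -> K^o) (f : series K) : K :=
  bilext peak_sets (Pi K) peak_sets (Kst K)
    (fun x y => (x == y)%:R : K^o) phi f.

Definition ppair2 (K : fieldType) (t : perms * perms -> K^o)
    (u : {cmonom nat} * {cmonom nat} -> K^o) : K :=
  bilext (peak_sets `*` peak_sets) (fun x => tens (Pi K x.1) (Pi K x.2))
         (peak_sets `*` peak_sets) (fun y => tens (Kst K y.1) (Kst K y.2))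
    (fun x y => ppair (Pi K x.1) (Kst K y.1) * ppair (Pi K x.2) (Kst K y.2)
                : K^o) t u.

(* Main.v *)
(* The transpose of theta is the algebra endomorphism of the descent algebra
   that maps Xi^n to q_n = 2 Pi^set0 (q_0 = 1).  These elements satisfy
   \sum_i (-1)^i Xi^i q_(n-i) = Xi^n, so the coefficients of q_n on the basis Xi
   define a character nu of the quasi-shuffle algebra, and theta(M_r) is obtained
   by cutting r into blocks and replacing each block u by nu(u) M_|u|.
   Deconcatenation being compatible with quasi-shuffles, theta is multiplicative;
   that this map sends F_D to K_(P(D)) is a computation letter by letter on
   descent words.

   Since Pi^P is the sum of the Delta^D with P(D) = P, one has
   <phi, f> = [phi, theta f] for phi in the peak algebra, hence the first claim.
   The coefficient of Delta^D (x) Delta^E in the coproduct of phi is <phi, F_D F_E>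
   = [phi, K_(P(D)) K_(P(E))]; it depends only on P(D) and P(E), which gives both
   the coalgebra property and the duality of product and coproduct. *)
Require Import Defs.
From mathcomp Require Import all_boot all_order all_algebra all_fingroup.
From mathcomp Require Import finmap.
From mathcomp Require Import zify ring.
From mathcomp.classical Require Import boolp classical_sets functions.
From mathcomp.classical Require Import cardinality fsbigop.
From mathcomp.multinomials Require Import monalg.
Set Implicit Arguments.
Unset Strict Implicit.
Unset Printing Implicit Defensive.
Import GRing.Theory.
Local Open Scope classical_set_scope.
Local Open Scope ring_scope.

(** All maps of the statement are linear extensions through chosen coordinates, so nothing can be
    computed before each family is known to be independent. For [Kst] this needs an order: the
    coefficient of K_P at a monomial with descent set Q is a power of 2 times a number of subsets.
    It vanishes unless P lies in the union of Q and Q + 1, and for P = Q the number is positive;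
    characteristic 0 keeps it nonzero. The map theta is given on the basis F, but its
    multiplicativity is visible only on M. The M-formula is therefore summed over all r above D and
    compared with K_(P(D)), coefficient by coefficient. The recursion on letters does not close on
    these sums alone: where both words have a non-descent, the first block collapses to a single
    unweighted letter. A second sum for that situation, and a memory of the preceding letters,
    repair this. One index set, the letterwise splittings of a word t, describes both the
    factorisations of a monomial with exponents t and the coproduct of Xi^t; this is why the product
    of Qsym is dual to the coproduct. *)

Local Notation span := Defs.span.
Local Notation coord := Defs.coord.

(** * Linear extension from an independent family *)

Definition independent (K : fieldType) (I : choiceType) (V : lmodType K)
    (A : set I) (b : I -> V) : Prop :=
  forall (c : I -> K) (s : seq I), uniq s -> (forall i, i \in s -> A i) ->
    \sum_(i <- s) c i *: b i = 0 -> forall i, i \in s -> c i = 0.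

Definition subspace (K : fieldType) (V : lmodType K) (S : set V) : Prop :=
  S 0 /\ forall (a : K) (v w : V), S v -> S w -> S (a *: v + w).

(** [coord] is chosen by [xget] and has a default value outside the span, so the extended maps can
    be linear only relative to a set of vectors. *)
Definition linear_on (K : fieldType) (V W : lmodType K) (S : set V)
    (f : V -> W) : Prop :=
  forall (a : K) (v w : V), S v -> S w -> f (a *: v + w) = a *: f v + f w.

(** Any duplicate-free list covering the support may serve as index set; sums with different
    supports can thus be brought to one common list. *)
Lemma fsum_seq (I : choiceType) (V : zmodType) (A : set I) (F : I -> V) (s : seq I) :
  uniq s -> (forall i, i \in s -> A i) ->
  (forall i, A i -> F i != 0 -> i \in s) ->
  \sum_(i \in A) F i = \sum_(i <- s) F i.
Proof.
move=> us sA As; rewrite (fsbigE s F us) //.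
  rewrite big_seq_cond [RHS]big_seq; apply: eq_bigl => i.
  by case: (boolP (i \in s)) => //= /sA Ai; rewrite mem_set.
by move=> i Ai; apply: contraNeq => /(As i Ai).
Qed.

Section LinearExtension.
Variable K : fieldType.

Section Subspace.
Variables (V W : lmodType K) (S : set V) (subS : subspace S).

Lemma subspaceD v w : S v -> S w -> S (v + w).
Proof. by move=> Sv Sw; rewrite -[v]scale1r; apply: subS.2. Qed.

Lemma subspaceZ a v : S v -> S (a *: v).
Proof. by move=> Sv; rewrite -[_ *: _]addr0; apply: subS.2 => //; apply: subS.1. Qed.

Lemma subspaceB v w : S v -> S w -> S (v - w).
Proof. by move=> Sv Sw; rewrite addrC -scaleN1r; apply: subS.2. Qed.

Lemma subspace_sum (J : eqType) (r : seq J) (P : pred J) (F : J -> V) :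
  (forall j, j \in r -> P j -> S (F j)) -> S (\sum_(j <- r | P j) F j).
Proof.
move=> SF; rewrite big_seq_cond; apply: (big_ind S); first exact: subS.1.
  exact: subspaceD.
by move=> j /andP[]; apply: SF.
Qed.

Variables (f : V -> W) (linf : linear_on S f).

Lemma linear_on0 : f 0 = 0.
Proof.
have := linf 1 subS.1 subS.1; rewrite !scale1r addr0 => /esym/eqP.
by rewrite -subr_eq0 addrK => /eqP.
Qed.

Lemma linear_onD v w : S v -> S w -> f (v + w) = f v + f w.
Proof. by move=> Sv Sw; rewrite -[v]scale1r linf // !scale1r. Qed.

Lemma linear_onZ a v : S v -> f (a *: v) = a *: f v.
Proof.
by move=> Sv; rewrite -[a *: v]addr0 linf ?linear_on0 ?addr0//; exact: subS.1.
Qed.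

Lemma linear_on_sum (J : eqType) (r : seq J) (P : pred J) (F : J -> V) :
  (forall j, j \in r -> P j -> S (F j)) ->
  f (\sum_(j <- r | P j) F j) = \sum_(j <- r | P j) f (F j).
Proof.
elim: r => [|j r IHr] SF; first by rewrite !big_nil linear_on0.
have SF' i : i \in r -> P i -> S (F i).
  by move=> ir; apply: SF; rewrite inE ir orbT.
rewrite !big_cons; case: ifP => Pj; last exact: IHr.
rewrite linear_onD ?IHr//; first by apply: SF; rewrite ?inE ?eqxx.
exact: subspace_sum.
Qed.

End Subspace.

Section Span.
Variables (I : choiceType) (V : lmodType K) (A : set I) (b : I -> V).

Lemma combinesP v (c : I -> K) : combines A b v c <->
  exists s : seq I, [/\ uniq s, forall i, i \in s -> A i,
    forall i, c i != 0 -> i \in s & v = \sum_(i <- s) c i *: b i].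
Proof.
have cb0 i : c i *: b i != 0 -> c i != 0.
  by apply: contraNneq => ->; rewrite scale0r.
split=> [[finc cA ->]|[s [us sA cs ->]]].
  exists (fset_set [set i | c i != 0]).
  have memc i : (i \in fset_set [set i | c i != 0]) = (c i != 0).
    by rewrite in_fset_set // mem_setE.
  split; first exact: fset_uniq.
  - by move=> i; rewrite memc => /cA.
  - by move=> i; rewrite memc.
  apply: fsum_seq; first exact: fset_uniq.
  - by move=> i; rewrite memc => /cA.
  - by move=> i _ /cb0; rewrite memc.
split.
- by apply: (sub_finite_set _ (finite_seq s)) => i /= /cs.
- by move=> i /= /cs/sA.
by rewrite (fsum_seq us sA) // => i _ /cb0/cs.
Qed.

Lemma combinesD a v w (c d : I -> K) : combines A b v c -> combines A b w d ->
  combines A b (a *: v + w) (fun i => a * c i + d i).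
Proof.
move=> [finc cA ->] [find dA ->].
pose r := fset_set ([set i | c i != 0] `|` [set i | d i != 0]).
have mr i : (i \in r) = (c i != 0) || (d i != 0).
  by rewrite in_fset_set ?finite_setU // in_setU !mem_setE.
have rA i : i \in r -> A i by rewrite mr => /orP[/cA|/dA].
have b0 (e : I -> K) i : e i *: b i != 0 -> e i != 0.
  by apply: contraNneq => ->; rewrite scale0r.
apply/combinesP; exists r; split => //.
  move=> i; rewrite mr; apply: contra_neqT.
  by rewrite negb_or !negbK => /andP[/eqP -> /eqP ->]; rewrite mulr0 addr0.
rewrite !(fsum_seq (fset_uniq r) rA); first last.
- by move=> i _ /b0 ci; rewrite mr ci.
- by move=> i _ /b0 ci; rewrite mr ci orbT.
rewrite scaler_sumr -big_split; apply: eq_bigr => i _.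
by rewrite scalerDl scalerA.
Qed.

Lemma span_subspace : subspace (span A b).
Proof.
split; first by exists (fun=> 0); apply/combinesP; exists [::]; split;
  rewrite ?big_nil//= => i; rewrite eqxx.
by move=> a v w [c cv] [d dw]; exists (fun i => a * c i + d i); apply: combinesD.
Qed.

Lemma span_basis i : A i -> span A b (b i).
Proof.
move=> Ai; exists (fun j => (j == i)%:R); apply/combinesP; exists [:: i]; split => //.
- by move=> j; rewrite inE => /eqP ->.
- by move=> j; rewrite inE; case: (eqVneq j i) => //= _; rewrite eqxx.
by rewrite big_seq1 eqxx scale1r.
Qed.

Lemma span_min (S : set V) : subspace S -> (forall i, A i -> S (b i)) ->
  span A b `<=` S.
Proof.
move=> subS Sb v [c /combinesP[s [_ sA _ ->]]].
by apply: subspace_sum => // i /sA Ai _; apply: (subspaceZ subS); apply: Sb.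
Qed.

Lemma span_ext (W : lmodType K) (f g : V -> W) :
  linear_on (span A b) f -> linear_on (span A b) g ->
  (forall i, A i -> f (b i) = g (b i)) -> forall v, span A b v -> f v = g v.
Proof.
move=> linf ling fg v [c /combinesP[s [_ sA _ ->]]].
have subS := span_subspace.
have Sb i : i \in s -> true -> span A b (c i *: b i).
  by move=> /sA Ai _; apply: (subspaceZ subS); apply: span_basis.
rewrite (linear_on_sum subS linf Sb) (linear_on_sum subS ling Sb).
apply: eq_big_seq => i /sA Ai; have Sbi := span_basis Ai.
by rewrite (linear_onZ subS linf) // (linear_onZ subS ling) // fg.
Qed.

Hypothesis indA : independent A b.

Lemma combines_uniq v (c d : I -> K) :
  combines A b v c -> combines A b v d -> c = d.
Proof.
move=> cc cd; apply: funext => i.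
have /combinesP[s [us sA cds]] := combinesD (-1) cd cc.
rewrite scaleN1r addNr => /esym /(indA us sA) s0.
apply/eqP; rewrite -subr_eq0 addrC -mulN1r.
by case: (boolP (i \in s)) => [/s0 ->|]; last apply: contraNT => /cds.
Qed.

Lemma coordE v (c : I -> K) : combines A b v c -> coord A b v = c.
Proof.
move=> cv; apply: (@combines_uniq v _ _ _ cv); rewrite /coord.
exact: (@xgetPex _ (fun=> 0) [set c | combines A b v c] (ex_intro _ c cv)).
Qed.

Lemma coord_combines v : span A b v -> combines A b v (coord A b v).
Proof. by move=> [c cv]; rewrite (coordE cv). Qed.

Lemma coord_basis i : A i -> coord A b (b i) = fun j => (j == i)%:R.
Proof.
move=> Ai; apply: coordE; apply/combinesP; exists [:: i]; split => //.
- by move=> j; rewrite inE => /eqP ->.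
- by move=> j; rewrite inE; case: (eqVneq j i) => //= _; rewrite eqxx.
by rewrite big_seq1 eqxx scale1r.
Qed.

Lemma coordD a v w : span A b v -> span A b w ->
  coord A b (a *: v + w) = fun i => a * coord A b v i + coord A b w i.
Proof. by move=> Sv Sw; apply/coordE/combinesD; apply: coord_combines. Qed.

End Span.

Section Linext.
Variables (I : choiceType) (V : lmodType K) (A : set I) (b : I -> V).
Hypothesis indA : independent A b.

Lemma linext_seq (W : lmodType K) (w : I -> W) v : span A b v ->
  exists s : seq I, [/\ uniq s, forall i, i \in s -> A i,
    forall i, coord A b v i != 0 -> i \in s &
    forall (W : lmodType K) (w : I -> W),
      linext A b w v = \sum_(i <- s) coord A b v i *: w i].
Proof.
move=> /(coord_combines indA) /combinesP[s [us sA cs _]]; exists s; split => //.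
move=> W' w'; apply: fsum_seq => // i _ ci; apply: cs.
by apply: contraNneq ci => ->; rewrite scale0r.
Qed.

Lemma linext_basis (W : lmodType K) (w : I -> W) i :
  A i -> linext A b w (b i) = w i.
Proof.
move=> Ai; rewrite /linext (@fsum_seq _ W _ _ [:: i]) //.
- by rewrite big_seq1 coord_basis // eqxx scale1r.
- by move=> j; rewrite inE => /eqP ->.
by move=> j _; rewrite coord_basis // inE; case: (eqVneq j i) => //= _; rewrite scale0r eqxx.
Qed.

Lemma linext_linear (W : lmodType K) (w : I -> W) :
  linear_on (span A b) (linext A b w).
Proof.
move=> a u v Su Sv; have Suv := (span_subspace A b).2 a u v Su Sv.
rewrite /linext coordD //.
have /combinesP[s [us sA cs _]] := coord_combines indA Su.
have /combinesP[t [ut tA dt _]] := coord_combines indA Sv.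
pose r := undup (s ++ t).
have ur : uniq r by exact: undup_uniq.
have rA i : i \in r -> A i by rewrite mem_undup mem_cat => /orP[/sA|/tA].
have cr i : coord A b u i != 0 -> i \in r.
  by move=> /cs; rewrite mem_undup mem_cat => ->.
have dr i : coord A b v i != 0 -> i \in r.
  by move=> /dt; rewrite mem_undup mem_cat => ->; rewrite orbT.
have b0 (e : I -> K) i : e i *: w i != 0 -> e i != 0.
  by apply: contraNneq => ->; rewrite scale0r.
rewrite !(fsum_seq ur rA).
- rewrite scaler_sumr -big_split; apply: eq_bigr => i _.
  by rewrite scalerDl scalerA.
- by move=> i _ /b0/dr.
- by move=> i _ /b0/cr.
move=> i _ /(b0 (fun i => a * coord A b u i + coord A b v i)) /=.
apply: contra_neqT => ir.
have -> : coord A b u i = 0 by apply/eqP; apply: contraNT ir => /cr.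
have -> : coord A b v i = 0 by apply/eqP; apply: contraNT ir => /dr.
by rewrite mulr0 addr0.
Qed.

Lemma linext_in (W : lmodType K) (w : I -> W) (S : set W) : subspace S ->
  (forall i, A i -> S (w i)) -> forall v, span A b v -> S (linext A b w v).
Proof.
move=> subS Sw v /(linext_seq w)[s [_ sA _ ->]].
by apply: subspace_sum => // i /sA Ai _; apply: (subspaceZ subS); apply: Sw.
Qed.

(** Linearity in the prescribed values rather than in the vector; this yields linearity of [bilext]
    in its second argument. *)
Lemma linext_linear_param (U W : lmodType K) (T : set U) (w : I -> U -> W) v :
  (forall i, A i -> linear_on T (w i)) -> span A b v ->
  linear_on T (fun u => linext A b (w^~ u) v).
Proof.
move=> linw Sv a x y Tx Ty; have [s [_ sA _ E]] := linext_seq (fun=> 0 : W) Sv.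
rewrite !E scaler_sumr -big_split; apply: eq_big_seq => i /sA Ai /=.
by rewrite linw // scalerDr !scalerA mulrC.
Qed.

End Linext.

Section Bilext.
Variables (I J : choiceType) (V V' W : lmodType K) (A : set I) (b : I -> V).
Variables (B : set J) (b' : J -> V') (w : I -> J -> W).
Hypotheses (indA : independent A b) (indB : independent B b').

Lemma bilext_linearl v' : linear_on (span A b) ((bilext A b B b' w)^~ v').
Proof. exact: linext_linear. Qed.

Lemma bilext_linearr v : span A b v ->
  linear_on (span B b') (bilext A b B b' w v).
Proof.
by apply: linext_linear_param => // i Ai; apply: linext_linear.
Qed.

Lemma bilext_basis i j : A i -> B j -> bilext A b B b' w (b i) (b' j) = w i j.
Proof. by move=> Ai Bj; rewrite /bilext !linext_basis. Qed.

End Bilext.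
End LinearExtension.

(** Evaluating a relation at [x i] leaves, besides the term of i, only terms of smaller rank, whose
    coefficients vanish by induction. When evaluation at the points [x i] is a Kronecker delta, a
    constant rank will do. *)
Lemma triangular_independent (K : fieldType) (I : choiceType) (X : Type)
    (A : set I) (b : I -> X -> K^o) (x : I -> X) (rank : I -> nat) :
  (forall i, A i -> b i (x i) != 0) ->
  (forall i j, A i -> A j -> b j (x i) != 0 -> i != j -> (rank j < rank i)%N) ->
  independent A b.
Proof.
move=> bxx bxy c s us sA sum0 i.
have [n] := ubnP (rank i); elim: n i => // n IHn i; rewrite ltnS => ltn si.
have := congr1 (fun f => f (x i)) sum0; rewrite /= fct_sumE (bigD1_seq i) //=.
rewrite [X in _ + X]big1_seq ?addr0.
  move=> /eqP; rewrite /= mulf_eq0 (negbTE (bxx i _)) ?orbF; last exact: sA.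
  by move/eqP.
move=> j /andP[ji sj]; case: (eqVneq (b j (x i)) 0) => [bji|bji].
  by change (c j * b j (x i) = 0); rewrite bji mulr0.
rewrite IHn ?scale0r //; apply: (leq_trans _ ltn); apply: bxy => //; do ?exact: sA.
by rewrite eq_sym.
Qed.

(** * Tensor products of spaces of functions *)

Section Tensor.
Variables (K : fieldType) (X Y : Type).

Lemma tens_linearl (g : Y -> K^o) :
  linear_on setT (fun f : X -> K^o => tens f g).
Proof.
move=> a f f' _ _; apply: funext => -[x y].
by rewrite /tens !fctE /= /GRing.scale /= mulrDl mulrA.
Qed.

Lemma tens_linearr (f : X -> K^o) :
  linear_on setT (fun g : Y -> K^o => tens f g).
Proof.
move=> a g g' _ _; apply: funext => -[x y].
by rewrite /tens !fctE /= /GRing.scale /= mulrDr mulrCA.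
Qed.

Variables (I J : choiceType) (A : set I) (B : set J).
Variables (b : I -> X -> K^o) (b' : J -> Y -> K^o).

(** For fixed y a relation becomes one between the [b i], with coefficients that are combinations of
    the values [b' j y]. These vanish for every y, and independence of [b'] finishes. *)
Lemma tens_independent : independent A b -> independent B b' ->
  independent (A `*` B) (fun x => tens (b x.1) (b' x.2)).
Proof.
move=> indb indb' c s us sAB sum0.
(* Extension by zero turns the arbitrary list of pairs s into a rectangle, over which the sum can be
   iterated. *)
pose c' p := if p \in s then c p else 0.
pose r := undup (map fst s); pose t := undup (map snd s).
have ur : uniq r by exact: undup_uniq.
have ut : uniq t by exact: undup_uniq.
have rA i : i \in r -> A i.
  by rewrite mem_undup => /mapP[p /sAB[Ap _] ->].
have tB j : j \in t -> B j.
  by rewrite mem_undup => /mapP[p /sAB[_ Bp] ->].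
have sumE (F : I * J -> X * Y -> K^o) :
    \sum_(p <- s) c p *: F p = \sum_(i <- r) \sum_(j <- t) c' (i, j) *: F (i, j).
  rewrite -(big_allpairs (F := fun p => c' p *: F p)) /=.
  rewrite [RHS](bigID (mem s)) /= [X in _ = _ + X]big1 ?addr0; last first.
    by move=> p /negbTE ps; rewrite /c' ps scale0r.
  rewrite -[RHS]big_filter big_seq (eq_bigr (fun p => c' p *: F p)); last first.
    by move=> p ps; rewrite /c' ps.
  rewrite -big_seq; apply: perm_big; apply: uniq_perm => //.
    by rewrite filter_uniq // allpairs_uniq // => -[? ?] [? ?] _ _ [-> ->].
  move=> [i j]; rewrite mem_filter /=; case: (boolP (_ \in s)) => //= ijs.
  apply/esym/allpairsP; exists (i, j); rewrite !mem_undup; split => //=.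
    by apply/mapP; exists (i, j).
  by apply/mapP; exists (i, j).
have c'0 i j : i \in r -> j \in t -> c' (i, j) = 0.
  move=> ir; apply: (indb' (fun j => c' (i, j)) t ut tB); apply: funext => y.
  rewrite fct_sumE; apply: (indb (fun i => \sum_(j <- t) (c' (i, j) *: b' j) y) r ur rA _ i ir).
  apply: funext => x; have := congr1 (fun f => f (x, y)) sum0.
  rewrite sumE !fct_sumE => sum0xy; rewrite -[RHS]sum0xy; apply: eq_bigr => k _.
  rewrite fct_sumE; change ((\sum_(j <- t) (c' (k, j) *: b' j) y) * b k x =
    \sum_(j <- t) c' (k, j) * (b k x * b' j y)).
  rewrite mulr_suml; apply: eq_bigr => l _.
  by change (c' (k, l) * b' l y * b k x = c' (k, l) * (b k x * b' l y));
    rewrite -mulrA [b' l y * _]mulrC.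
move=> [i j] ijs; have := c'0 i j; rewrite /c' ijs; apply.
  by rewrite mem_undup; apply/mapP; exists (i, j).
by rewrite mem_undup; apply/mapP; exists (i, j).
Qed.

End Tensor.

(** * Compositions of n.+1 as bit sequences of length n *)

Fixpoint bitseqs (n : nat) : seq bitseq :=
  if n is m.+1 then map (cons true) (bitseqs m) ++ map (cons false) (bitseqs m)
  else [:: [::]].

Definition bitset (b : bitseq) : {fset nat} :=
  [fset i in iota 1 (size b) | nth false b i.-1]%fset.

(** A bit tells whether a cut follows the current unit: [true] makes it a part of its own, [false]
    joins it to the next part. Recursion on bits is thus recursion on compositions unit by unit, the
    form in which theta of a fundamental function is computed. *)
Fixpoint bitcomp (b : bitseq) : seq nat :=
  if b is c :: b' then
    let q := bitcomp b' in if c then 1%N :: q else (head 0%N q).+1 :: behead q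
  else [:: 1%N].

Definition comps (n : nat) : seq (seq nat) :=
  if n is m.+1 then map bitcomp (bitseqs m) else [:: [::]].

Lemma mem_bitseqs n b : (b \in bitseqs n) = (size b == n).
Proof.
elim: n b => [|n IHn] [|c b] //=; rewrite mem_cat.
  by apply/negbTE; rewrite negb_or; apply/andP; split; apply/negP => /mapP[].
have inj d : injective (cons d : bitseq -> bitseq) by move=> x y [].
case: c; rewrite mem_map // eqSS IHn; last by apply/orb_idl => /mapP[].
by apply/orb_idr => /mapP[].
Qed.

Lemma bitseqs_uniq n : uniq (bitseqs n).
Proof.
elim: n => //= n IHn.
have inj d : injective (cons d : bitseq -> bitseq) by move=> x y [].
rewrite cat_uniq !map_inj_uniq // IHn andbT /=.
by apply/hasPn => _ /mapP[x _ ->]; apply/negP => /mapP[].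
Qed.

Lemma in_zint a b i : (i \in zint a b) = (a <= i <= b)%N.
Proof.
rewrite !inE /= mem_iota; apply: andb_id2l => ai.
by case: (leqP a b.+1) => [/subnKC -> //|ba]; lia.
Qed.

Lemma in_bitset b i : (i \in bitset b) = (0 < i)%N && nth false b i.-1.
Proof.
rewrite !inE /= mem_iota -andbA add1n; apply: andb_id2l => i0; apply/andb_idl.
by case: i i0 => // i _ /=; rewrite ltnS ltnNge; apply: contraL => /(nth_default false) ->.
Qed.

Lemma bitset_inj b b' : size b = size b' -> bitset b = bitset b' -> b = b'.
Proof.
move=> eqs /fsetP eqb; apply: (@eq_from_nth _ false) => // i _.
by have := eqb i.+1; rewrite !in_bitset.
Qed.

Lemma bitset_sub b : (bitset b `<=` zint 1 (size b))%fset.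
Proof.
apply/fsubsetP => -[|i]; rewrite in_bitset in_zint //=.
by case: (leqP (size b) i) => // /(nth_default false) ->.
Qed.

Lemma bitset_surj n (D : {fset nat}) : (D `<=` zint 1 n)%fset ->
  exists2 b, size b = n & bitset b = D.
Proof.
move=> /fsubsetP Dn; exists (mkseq (fun i => i.+1 \in D) n).
  by rewrite size_mkseq.
apply/fsetP => -[|i]; rewrite in_bitset /=.
  by apply/esym/negbTE/negP => /Dn; rewrite in_zint.
case: (leqP n i) => [ni|ni]; last by rewrite nth_mkseq.
rewrite nth_default ?size_mkseq //; apply/esym/negbTE/negP => /Dn.
by rewrite in_zint; lia.
Qed.

Lemma perm_fpowerset n :
  perm_eq (fpowerset (zint 1 n)) (map bitset (bitseqs n)).
Proof.
apply: uniq_perm; first exact: fset_uniq.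
  rewrite map_inj_in_uniq ?bitseqs_uniq // => b b'.
  by rewrite !mem_bitseqs => /eqP sb /eqP sb'; apply: bitset_inj; rewrite sb.
move=> D; rewrite fpowersetE; apply/idP/mapP.
  by move=> /bitset_surj[b sb <-]; exists b; rewrite // mem_bitseqs sb.
by move=> [b]; rewrite mem_bitseqs => /eqP <- ->; apply: bitset_sub.
Qed.

Lemma bitcomp_neq0 b : bitcomp b = head 0%N (bitcomp b) :: behead (bitcomp b).
Proof. by case: b => //= -[]. Qed.

Lemma bitcomp_pos b : all (leq 1) (bitcomp b).
Proof.
by elim: b => //= -[] b //=; rewrite bitcomp_neq0 /= => /andP[_].
Qed.

Lemma sumn_bitcomp b : sumn (bitcomp b) = (size b).+1.
Proof. by elim: b => //= -[] b /= <- //; rewrite [in RHS]bitcomp_neq0. Qed.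

Lemma mem_Dset q x : reflect (exists2 i, (0 < i < size q)%N & x = sumn (take i q))
  (x \in Dset q).
Proof.
apply: (iffP (imfsetP _ _ _ _)) => -[i]; rewrite /= ?mem_iota => iq ->; exists i => //.
  by case: q iq => [|k q] //=; rewrite ?add1n; lia.
by rewrite mem_iota; case: q iq => [|k q] //=; rewrite ?add1n; lia.
Qed.

Lemma Dset_bitcomp b : Dset (bitcomp b) = bitset b.
Proof.
elim: b => [|c b IHb].
  apply/fsetP => x; rewrite in_bitset nth_nil andbF.
  by apply/negbTE/negP => /mem_Dset[[|[]]].
have IH x : (x.+1 \in bitset (c :: b)) = (c && (x == 0%N)) || (x \in Dset (bitcomp b)).
  by rewrite IHb !in_bitset; case: x => [|x] /=; rewrite ?orbF ?andbT ?andbF.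
apply/fsetP => -[|x].
  rewrite in_bitset; apply/negbTE/negP => /mem_Dset[[|i] //= _].
  by case: c {IH}; rewrite ?add1n ?addSn.
rewrite IH /=; apply/mem_Dset/orP.
  case: c {IH} => /= -[[|i] //= iq]; last first.
    rewrite addSn => -[->]; right; apply/mem_Dset; exists i.+1.
      by rewrite bitcomp_neq0.
    by rewrite [in RHS]bitcomp_neq0.
  rewrite add1n => -[->]; case: i iq => [|i] iq; first by left; rewrite take0.
  by right; apply/mem_Dset; exists i.+1.
move=> [/andP[-> /eqP ->]|/mem_Dset[[|i] // iq ->]].
  by exists 1%N; rewrite /= ?take0 //; rewrite bitcomp_neq0.
case: c {IH}; first by exists i.+2 => //=.
by exists i.+1; [rewrite bitcomp_neq0 in iq | rewrite [in LHS]bitcomp_neq0].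
Qed.

Lemma bitcomp_inj : injective bitcomp.
Proof.
move=> b b' eqb; apply: bitset_inj; last by rewrite -!Dset_bitcomp eqb.
by apply: succn_inj; rewrite -!sumn_bitcomp eqb.
Qed.

Lemma bitcomp_surj q : all (leq 1) q -> q != [::] -> exists b, bitcomp b = q.
Proof.
elim: q => // -[//|k] q IHq /= qpos _; elim: k => [|k [b bq]].
  case: (eqVneq q [::]) => [->|/(IHq qpos)[b <-]]; first by exists [::].
  by exists (true :: b).
by exists (false :: b); rewrite /= bq.
Qed.

Lemma mem_comps n q : (q \in comps n) = all (leq 1) q && (sumn q == n).
Proof.
case: n => [|n] /=.
  rewrite inE; apply/eqP/andP => [->|[qpos]] //.
  by case: q qpos => // -[].
apply/mapP/andP => [[b bn ->]|[qpos /eqP qn]].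
  by rewrite bitcomp_pos sumn_bitcomp eqSS -mem_bitseqs.
have [|b bq] := bitcomp_surj qpos; first by apply/eqP => q0; rewrite q0 in qn.
by exists b => //; rewrite mem_bitseqs -eqSS -sumn_bitcomp bq qn.
Qed.

Lemma comps_uniq n : uniq (comps n).
Proof. by case: n => //= n; rewrite map_inj_uniq ?bitseqs_uniq //; apply: bitcomp_inj. Qed.

Lemma Dset_nil : Dset [::] = fset0.
Proof. by apply/fsetP => x; rewrite inE; apply/negbTE/negP => /mem_Dset[i]; rewrite andbC. Qed.

Lemma Dset_inj q q' : all (leq 1) q -> all (leq 1) q' -> sumn q = sumn q' ->
  Dset q = Dset q' -> q = q'.
Proof.
move=> qpos q'pos; case: (eqVneq q [::]) => [->|q0].
  by case: q' q'pos => // -[].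
case: (eqVneq q' [::]) => [->|q'0]; first by case: q qpos q0 => // -[].
have [b <-] := bitcomp_surj qpos q0; have [b' <-] := bitcomp_surj q'pos q'0.
rewrite !sumn_bitcomp !Dset_bitcomp => -[sb] eqb.
by rewrite (bitset_inj sb eqb).
Qed.

Lemma Dset_sub q : all (leq 1) q -> (Dset q `<=` zint 1 (sumn q).-1)%fset.
Proof.
move=> qpos; case: (eqVneq q [::]) => [->|q0]; first by rewrite Dset_nil fsub0set.
have [b <-] := bitcomp_surj qpos q0.
by rewrite Dset_bitcomp sumn_bitcomp bitset_sub.
Qed.

Lemma Dset_surj n (D : {fset nat}) : (D `<=` zint 1 n.-1)%fset ->
  exists q, [/\ all (leq 1) q, sumn q = n & Dset q = D].
Proof.
case: n => [|n] Dn; last first.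
  have [b sb <-] := bitset_surj Dn; exists (bitcomp b).
  by rewrite bitcomp_pos sumn_bitcomp sb Dset_bitcomp.
exists [::]; split => //; apply/fsetP => x; rewrite Dset_nil inE.
by apply/esym/negbTE/negP => /(fsubsetP Dn); rewrite in_zint /=; lia.
Qed.

(** * Quasi-shuffles and the character defining theta *)

(** The list keeps multiplicities, which are the structure constants of the monomial basis. The
    inner [fix] serves the branch that consumes a letter of s only. *)
Fixpoint qshuffle (r : seq nat) : seq nat -> seq (seq nat) :=
  fix aux s :=
    if r is a :: r' then
      if s is b :: s' then
        map (cons a) (qshuffle r' s) ++
        (map (cons b) (aux s') ++ map (cons (a + b)%N) (qshuffle r' s'))
      else [:: r]
    else [:: s].

Fixpoint deconcat (r : seq nat) : seq (seq nat * seq nat) :=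
  ([::], r) ::
  (if r is a :: r' then map (fun p => (a :: p.1, p.2)) (deconcat r') else [::]).

(** Zeros are allowed in both halves: a letter 0 stands for a variable missing from a factor, or for
    Xi^0 in a coproduct. *)
Fixpoint splits (t : seq nat) : seq (seq nat * seq nat) :=
  if t is k :: t' then
    [seq (j :: p.1, (k - j)%N :: p.2) | j <- iota 0 k.+1, p <- splits t']
  else [:: ([::], [::])].

Arguments qshuffle : simpl never.
Arguments splits : simpl never.

Lemma qshuffle_nill s : qshuffle [::] s = [:: s]. Proof. by case: s. Qed.
Lemma qshuffle_nilr r : qshuffle r [::] = [:: r]. Proof. by case: r. Qed.
Lemma qshuffle_cons a r b s : qshuffle (a :: r) (b :: s) =
  map (cons a) (qshuffle r (b :: s)) ++
  (map (cons b) (qshuffle (a :: r) s) ++ map (cons (a + b)%N) (qshuffle r s)).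
Proof. by []. Qed.

Lemma qshuffle_ind (P : seq nat -> seq nat -> Prop) :
  (forall s, P [::] s) -> (forall r, P r [::]) ->
  (forall a r b s, P r (b :: s) -> P (a :: r) s -> P r s ->
    P (a :: r) (b :: s)) -> forall r s, P r s.
Proof.
move=> P0l P0r IH; elim=> // a r IHr; elim=> // b s IHs; exact: IH.
Qed.

Lemma big_splits_cons (V : nmodType) (F : seq nat * seq nat -> V) k t :
  \sum_(p <- splits (k :: t)) F p =
  \sum_(j <- iota 0 k.+1) \sum_(p <- splits t) F (j :: p.1, (k - j)%N :: p.2).
Proof. by rewrite [splits _]/splits -/splits big_allpairs_dep. Qed.

Lemma exchange_big4 (V : nmodType) (I1 I2 J1 J2 : Type) (r1 : seq I1)
    (r2 : seq I2) (s1 : seq J1) (s2 : seq J2) (F : I1 -> I2 -> J1 -> J2 -> V) :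
  \sum_(i <- r1) \sum_(i' <- r2) \sum_(j <- s1) \sum_(j' <- s2) F i i' j j' =
  \sum_(j <- s1) \sum_(j' <- s2) \sum_(i <- r1) \sum_(i' <- r2) F i i' j j'.
Proof.
under eq_bigr do rewrite exchange_big.
rewrite exchange_big; apply: eq_bigr => j _ /=.
under eq_bigr do rewrite exchange_big.
exact: exchange_big.
Qed.

Lemma sumn_qshuffle r s u : u \in qshuffle r s -> sumn u = (sumn r + sumn s)%N.
Proof.
move: r s u; apply: qshuffle_ind => [s|r|a r b s IH1 IH2 IH3] u.
- by rewrite qshuffle_nill inE => /eqP ->.
- by rewrite qshuffle_nilr inE addn0 => /eqP ->.
rewrite qshuffle_cons !mem_cat => /or3P[] /mapP[v vq ->] /=.
- by rewrite (IH1 _ vq) /= addnA.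
- by rewrite (IH2 _ vq) /= addnCA.
by rewrite (IH3 _ vq) addnACA.
Qed.

Lemma all_qshuffle r s u : all (leq 1) r -> all (leq 1) s ->
  u \in qshuffle r s -> all (leq 1) u.
Proof.
move: r s u; apply: qshuffle_ind => [s|r|a r b s IH1 IH2 IH3] u.
- by rewrite qshuffle_nill inE => _ ? /eqP ->.
- by rewrite qshuffle_nilr inE => ? _ /eqP ->.
move=> /= /andP[a0 r0] /andP[b0 s0].
rewrite qshuffle_cons !mem_cat => /or3P[] /mapP[v vq ->] /=.
- by rewrite a0 (IH1 _ r0 _ vq) //= b0.
- by rewrite b0 (IH2 _ _ s0 vq) //= a0.
by rewrite (IH3 _ r0 s0 vq) andbT addn_gt0 a0.
Qed.

Section Character.
Variable K : comNzRingType.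

Lemma big_qshuffle_cons (V : nmodType) (F : seq nat -> V) a r b s :
  \sum_(u <- qshuffle (a :: r) (b :: s)) F u =
  \sum_(u <- qshuffle r (b :: s)) F (a :: u) +
  (\sum_(u <- qshuffle (a :: r) s) F (b :: u) +
   \sum_(u <- qshuffle r s) F ((a + b)%N :: u)).
Proof. by rewrite qshuffle_cons !big_cat !big_map. Qed.

Lemma big_deconcat_cons (V : nmodType) (F : seq nat * seq nat -> V) a r :
  \sum_(p <- deconcat (a :: r)) F p =
  F ([::], a :: r) + \sum_(p <- deconcat r) F (a :: p.1, p.2).
Proof. by rewrite /= big_cons big_map. Qed.

Lemma deconcat_sumn r p : p \in deconcat r -> (sumn p.1 + sumn p.2 = sumn r)%N.
Proof.
elim: r p => [|a r IHr] p; first by rewrite inE => /eqP ->.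
by rewrite inE => /orP[/eqP -> //|/mapP[p' /IHr E ->]] /=; rewrite -E addnA.
Qed.

Lemma deconcat_pos r p : all (leq 1) r -> p \in deconcat r ->
  all (leq 1) p.1 && all (leq 1) p.2.
Proof.
elim: r p => [|a r IHr] p; first by rewrite inE => _ /eqP ->.
move=> /= /andP[a0 r0]; rewrite inE => /orP[/eqP -> /=|/mapP[p' pr ->]].
  by rewrite a0 r0.
by rewrite /= a0; apply: IHr.
Qed.

(** The compatibility axiom of the quasi-shuffle bialgebra. By induction on the first letter of the
    left half, which is a, b or a + b unless that half is empty. *)
Lemma deconcat_qshuffle (V : nmodType) (F : seq nat -> seq nat -> V) r s :
  \sum_(u <- qshuffle r s) \sum_(p <- deconcat u) F p.1 p.2 =
  \sum_(p <- deconcat r) \sum_(q <- deconcat s)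
    \sum_(v <- qshuffle p.1 q.1) \sum_(w <- qshuffle p.2 q.2) F v w.
Proof.
move: r s F; apply: qshuffle_ind => [s|r|a r b s IH1 IH2 IH3] F.
- rewrite qshuffle_nill !big_seq1; apply: eq_bigr => p _.
  by rewrite !qshuffle_nill !big_seq1.
- rewrite qshuffle_nilr !big_seq1; apply: eq_bigr => p _.
  by rewrite big_seq1 !qshuffle_nilr !big_seq1.
have step (c : nat) l :
    \sum_(u <- l) \sum_(p <- deconcat (c :: u)) F p.1 p.2 =
    \sum_(u <- l) F [::] (c :: u) +
    \sum_(u <- l) \sum_(p <- deconcat u) F (c :: p.1) p.2.
  by rewrite -big_split; apply: eq_bigr => u _; rewrite big_deconcat_cons.
rewrite big_qshuffle_cons !step (IH1 (fun v w => F (a :: v) w)).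
rewrite (IH2 (fun v w => F (b :: v) w)) (IH3 (fun v w => F ((a + b)%N :: v) w)).
have splitl (G : seq nat * seq nat -> seq nat * seq nat -> V) c t l :
    \sum_(p <- l) \sum_(q <- deconcat (c :: t)) G p q =
    \sum_(p <- l) G p ([::], c :: t) +
    \sum_(p <- l) \sum_(q <- deconcat t) G p (c :: q.1, q.2).
  by rewrite -big_split; apply: eq_bigr => p _; rewrite big_deconcat_cons.
rewrite [RHS]big_deconcat_cons !splitl !big_deconcat_cons /=.
rewrite [X in _ = X + _ + _]big_seq1 big_qshuffle_cons.
rewrite [X in _ = _ + (_ + X)](eq_bigr (fun p => \sum_(q <- deconcat s)
    \sum_(v <- qshuffle p.1 (b :: q.1)) \sum_(w <- qshuffle p.2 q.2) F (a :: v) w +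
  (\sum_(q <- deconcat s)
    \sum_(v <- qshuffle (a :: p.1) q.1) \sum_(w <- qshuffle p.2 q.2) F (b :: v) w +
   \sum_(q <- deconcat s) \sum_(v <- qshuffle p.1 q.1)
      \sum_(w <- qshuffle p.2 q.2) F ((a + b)%N :: v) w))); last first.
  by move=> p _; rewrite -!big_split; apply: eq_bigr => q _;
    rewrite big_qshuffle_cons.
rewrite !big_split /=.
(* If the left half taken from one word is empty, only one first letter is possible. Written as
   quasi-shuffles with the empty word, these terms match the boundary terms of the inductive
   hypotheses. *)
rewrite [X in _ = _ + X + _](eq_bigr (fun q =>
  \sum_(v <- qshuffle [::] q.1) \sum_(w <- qshuffle (a :: r) q.2) F (b :: v) w));
  last by move=> q _; rewrite !qshuffle_nill !big_seq1.
rewrite [X in _ = _ + (X + _)](eq_bigr (fun p =>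
  \sum_(v <- qshuffle p.1 [::]) \sum_(w <- qshuffle p.2 (b :: s)) F (a :: v) w));
  last by move=> p _; rewrite !qshuffle_nilr !big_seq1.
set X1 := \sum_(u <- qshuffle r _) _; set X2 := \sum_(u <- qshuffle _ s) _.
set X3 := \sum_(u <- qshuffle r s) _.
set B0 := \sum_(q <- deconcat s) _.
set A0 := \sum_(p <- deconcat r) \sum_(v <- _) _.
rewrite -![in LHS]addrA -![in RHS]addrA; congr (_ + _).
rewrite !(addrCA _ X2); congr (_ + _).
rewrite !(addrCA _ X3); congr (_ + _).
by rewrite !(addrCA _ B0).
Qed.

(* The coefficient of Xi^u in q_n, where n is the sum of u. *)
Fixpoint nu (u : seq nat) : K :=
  if u is k :: w then (w == [::])%:R - (-1) ^+ k * nu w else 1.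

(* The coefficient of M_t in theta(M_r). *)
Fixpoint thetaM (r t : seq nat) : K :=
  if t is k :: t' then
    \sum_(p <- deconcat r) (sumn p.1 == k)%:R * nu p.1 * thetaM p.2 t'
  else (r == [::])%:R.

Lemma thetaM_cons r k t : thetaM r (k :: t) =
  \sum_(p <- deconcat r) (sumn p.1 == k)%:R * nu p.1 * thetaM p.2 t.
Proof. by []. Qed.

Lemma qshuffle_counit r s :
  \sum_(u <- qshuffle r s) (u == [::])%:R = (r == [::])%:R * (s == [::])%:R :> K.
Proof.
case: r s => [|a r] [|b s]; rewrite ?qshuffle_nill ?qshuffle_nilr ?big_seq1 /=;
  rewrite ?mul1r ?mulr1 //.
by rewrite big_qshuffle_cons !big1 // !addr0 mulr0.
Qed.

(** Put x = (-1)^a nu(r), y = (-1)^b nu(s), and let e, f be 1 or 0 according to whether r, s are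
    empty. The first letters a, b and a + b contribute -x(f - y), -(e - x)y and ef - xy, with total
    (e - x)(f - y). *)
Lemma nu_qshuffle r s : \sum_(u <- qshuffle r s) nu u = nu r * nu s.
Proof.
move: r s; apply: qshuffle_ind => [s|r|a r b s IH1 IH2 IH3].
- by rewrite qshuffle_nill big_seq1 mul1r.
- by rewrite qshuffle_nilr big_seq1 mulr1.
rewrite big_qshuffle_cons /= !sumrB -!mulr_sumr IH1 IH2 IH3 !qshuffle_counit /=.
by rewrite exprD; ring.
Qed.

Lemma thetaM_qshuffle r s t :
  \sum_(u <- qshuffle r s) thetaM u t =
  \sum_(p <- splits t) thetaM r p.1 * thetaM s p.2.
Proof.
elim: t r s => [|k t IHt] r s; first by rewrite big_seq1 qshuffle_counit.
rewrite big_splits_cons (deconcat_qshuffle (fun v w => (sumn v == k)%:R * nu v * thetaM w t)).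
transitivity (\sum_(p <- deconcat r) \sum_(q <- deconcat s)
    \sum_(j <- iota 0 k.+1) \sum_(x <- splits t)
    ((sumn p.1 == j)%:R * nu p.1 * thetaM p.2 x.1) *
    ((sumn q.1 == k - j)%N%:R * nu q.1 * thetaM q.2 x.2)); last first.
  rewrite exchange_big4; apply: eq_bigr => j _; apply: eq_bigr => x _.
  by rewrite big_distrlr.
apply: eq_bigr => p _; apply: eq_bigr => q _.
transitivity ((sumn p.1 + sumn q.1 == k)%:R * (nu p.1 * nu q.1) *
   \sum_(x <- splits t) thetaM p.2 x.1 * thetaM q.2 x.2).
  rewrite -IHt -nu_qshuffle -mulrA big_distrlr mulr_sumr.
  apply: eq_big_seq => v vq /=; rewrite mulr_sumr.
  by apply: eq_bigr => w _; rewrite (sumn_qshuffle vq) mulrA.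
(* The block of weight k mixes a block of r with a block of s; the weight j of the former is the
   first entry of the splitting of k, and either block may be empty. *)
have -> : (sumn p.1 + sumn q.1 == k)%:R =
    \sum_(j <- iota 0 k.+1) (sumn p.1 == j)%:R * (sumn q.1 == k - j)%N%:R :> K.
  case: eqP => [<-|neqk].
    rewrite (bigD1_seq (sumn p.1)) ?iota_uniq ?mem_iota ?ltnS ?leq_addr //=.
    rewrite eqxx addKn eqxx mul1r big1 ?addr0 // => j.
    by rewrite eq_sym => /negbTE ->; rewrite mul0r.
  rewrite big1_seq // => j; rewrite mem_iota /= => jk.
  case: eqP; rewrite ?mul0r // => pj; case: eqP; rewrite ?mulr0 // => qj.
  by case: neqk; lia.
rewrite !mulr_suml; apply: eq_bigr => j _.
rewrite mulr_sumr; apply: eq_bigr => x _; ring.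
Qed.

Lemma thetaM_sumn r t : sumn r != sumn t -> thetaM r t = 0.
Proof.
elim: t r => [|k t IHt] r; first by case: r => //=; rewrite eqxx.
move=> rt /=; rewrite big1_seq // => p /= /deconcat_sumn pr.
case: eqP => [pk|]; last by rewrite !mul0r.
by rewrite IHt ?mulr0 //; apply: contraNneq rt => pt; rewrite -pr pk pt.
Qed.

(** A letter 0 of t can only be matched by an empty block of a positive word, and nu is 1 there.
    This absorbs the zeros produced by [splits]. *)
Lemma thetaM_pos r t : all (leq 1) r ->
  thetaM r t = thetaM r (filter (leq 1) t).
Proof.
elim: t r => [|[|k] t IHt] r rpos //=; last first.
  apply: eq_big_seq => p /(deconcat_pos rpos)/andP[_ p2].
  by rewrite IHt.
have -> : deconcat r = ([::], r) :: behead (deconcat r) by case: r {rpos}.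
rewrite big_cons /= !mul1r -IHt // big1_seq ?addr0 // => p /=.
case: r rpos => //= a r /andP[a0 _] /mapP[q _ ->] /=.
by rewrite addn_eq0 -(prednK a0) !mul0r.
Qed.

End Character.

Arguments thetaM : simpl never.

Local Notation nz := (filter (leq 1)).

(** Both sides are the coefficient of M_u in M_r M_s: each letter of u comes from r alone, from s
    alone, or from a letter of each, according to which halves of its splitting are nonzero. *)
Lemma qshuffle_splits (K : comNzRingType) u r s :
  all (leq 1) u -> all (leq 1) r -> all (leq 1) s ->
  \sum_(v <- qshuffle r s) (u == v)%:R =
  \sum_(p <- splits u) (nz p.1 == r)%:R * (nz p.2 == s)%:R :> K.
Proof.
elim: u r s => [|[//|k] u IHu] r s /= upos rpos spos.
  rewrite big_seq1 /= ![[::] == _]eq_sym -qshuffle_counit.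
  by apply: eq_bigr => v _; rewrite eq_sym.
have eqc (a b : nat) (q q' : seq nat) :
    (a :: q == b :: q')%:R = (a == b)%:R * (q == q')%:R :> K.
  by rewrite eqseq_cons; case: (a == b); rewrite ?mul1r ?mul0r.
rewrite big_splits_cons.
(* The value j = 0 is a letter taken from s, j = [k.+1] one taken from r, and the values in between
   are merged letters. *)
have -> : iota 0 k.+2 = 0%N :: rcons (iota 1 k) k.+1.
  by rewrite -[k.+2]addn1 iotaD /= add0n cats1.
rewrite big_cons -cats1 big_cat big_seq1 /= subn0 subnn /=.
case: r rpos => [|a r] /= rpos.
  rewrite [X in _ + (_ + X)]big1 ?addr0; last by move=> p _; rewrite mul0r.
  rewrite [X in _ + X]big1_seq ?addr0; last first.
    move=> j; rewrite mem_iota /= => /andP[j0 _]; rewrite j0.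
    by rewrite big1 // => p _; rewrite mul0r.
  case: s spos => [|b s] /= spos.
    rewrite qshuffle_nill big_seq1 big1 // => p _; rewrite mulr0 //.
  transitivity ((k.+1 == b)%:R * \sum_(v <- qshuffle [::] s) (u == v)%:R : K).
    by rewrite !qshuffle_nill !big_seq1 eqc.
  rewrite IHu //; last by case/andP: spos.
  by rewrite mulr_sumr; apply: eq_bigr => p _; rewrite eqc mulrCA.
case: s spos => [|b s] /= spos.
  rewrite [X in X + _]big1 ?add0r; last by move=> p _; rewrite mulr0.
  rewrite [X in X + _]big1_seq ?add0r; last first.
    move=> j; rewrite mem_iota /= => /andP[j0 jk].
    have -> : (0 < k.+1 - j)%N by lia.
    by rewrite big1 // => p _; rewrite mulr0.
  transitivity ((k.+1 == a)%:R * \sum_(v <- qshuffle r [::]) (u == v)%:R : K).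
    by rewrite !qshuffle_nilr !big_seq1 eqc.
  rewrite IHu //; last by case/andP: rpos.
  by rewrite mulr_sumr; apply: eq_bigr => p _; rewrite eqc mulrA.
have [a0 r0] := andP rpos; have [b0 s0] := andP spos.
rewrite big_qshuffle_cons.
rewrite [X in X + _ = _](eq_bigr _ (fun v _ => eqc _ _ _ _)).
rewrite [X in _ + (X + _) = _](eq_bigr _ (fun v _ => eqc _ _ _ _)).
rewrite [X in _ + (_ + X) = _](eq_bigr _ (fun v _ => eqc _ _ _ _)).
rewrite -!mulr_sumr !IHu //= [LHS]addrC -[LHS]addrA; congr (_ + _).
  by rewrite mulr_sumr; apply: eq_bigr => p _; rewrite eqc mulrCA.
congr (_ + _); last first.
  by rewrite mulr_sumr; apply: eq_bigr => p _; rewrite eqc mulrA.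
have -> : (k.+1 == a + b)%N%:R =
    \sum_(j <- iota 1 k) (j == a)%:R * (k.+1 - j == b)%N%:R :> K.
  case: eqP => [kab|neqk].
    rewrite (bigD1_seq a) ?iota_uniq ?mem_iota ?a0 /=; [|lia|by []].
    have -> : (k.+1 - a == b)%N by apply/eqP; lia.
    by rewrite eqxx mul1r big1 ?addr0 // => j /negbTE ->; rewrite mul0r.
  rewrite big1_seq // => j; rewrite mem_iota /= => jk.
  case: eqP; rewrite ?mul0r // => pj; case: eqP; rewrite ?mulr0 // => qj.
  by case: neqk; lia.
rewrite mulr_suml; apply: eq_big_seq => j; rewrite mem_iota => /andP[j0 jk].
rewrite j0; have -> : (0 < k.+1 - j)%N by lia.
rewrite mulr_sumr; apply: eq_bigr => p _; rewrite !eqc; ring.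
Qed.

(** * Theta on the fundamental basis, by recursion on bit sequences *)

Definition bitle (b b' : bitseq) : bool := all2 implb b b'.

Lemma bitleE b b' : size b = size b' ->
  bitle b b' = (bitset b `<=` bitset b')%fset.
Proof.
move=> sb; apply/idP/fsubsetP => [bb' i|bb'].
  rewrite !in_bitset => /andP[-> /=]; move: i.-1 => {}i.
  elim: b b' sb bb' i => [|c b IHb] [|c' b'] //= [sb] /andP[cc' bb'] [|i] /=.
    by move/implyP: cc'.
  exact: IHb.
have {}bb' i : nth false b i -> nth false b' i.
  by have := bb' i.+1; rewrite !in_bitset.
elim: b b' sb bb' => [|c b IHb] [|c' b'] //= [sb] bb'.
apply/andP; split; first by apply/implyP => /(bb' 0%N).
by apply: IHb => // i /(bb' i.+1).
Qed.

Lemma card_bitset b : size (bitset b) = count id b.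
Proof.
have sE : perm_eq (bitset b) [seq i <- iota 1 (size b) | nth false b i.-1].
  apply: uniq_perm; first exact: fset_uniq.
    by rewrite filter_uniq ?iota_uniq.
  by move=> i; rewrite !inE /= mem_filter andbC.
rewrite (perm_size sE) size_filter (iotaDl 1 0) count_map.
rewrite -[in RHS](mkseq_nth false b) count_map.
exact: eq_count.
Qed.

Lemma deconcat_nil (K : comNzRingType) (F : seq nat * seq nat -> K) r :
  \sum_(p <- deconcat r) (p.1 == [::])%:R * F p = F ([::], r).
Proof.
have -> : deconcat r = ([::], r) :: behead (deconcat r) by case: r.
rewrite big_cons mul1r big1_seq ?addr0 //; case: r => //= a r p /mapP[q _ ->].
by rewrite mul0r.
Qed.

Section ThetaFundamental.
Variable K : comNzRingType.
Notation nu := (@nu K).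
Notation thetaM := (@thetaM K).

(** The first block is forced to be the single letter 1, and nu(1) = 2. *)
Lemma thetaM_11 r t : all (leq 1) r ->
  thetaM (1%N :: r) (1%N :: t) = 2 * thetaM r t.
Proof.
move=> rpos; rewrite thetaM_cons big_deconcat_cons /= !mul0r add0r.
rewrite -(deconcat_nil (fun p => 2 * thetaM p.2 t)).
apply: eq_big_seq => p /(deconcat_pos rpos)/andP[p1 _].
case: p.1 p1 => [|[|k] u] //= _; last by rewrite !mul0r.
by rewrite !mul1r mulr1 expr1 opprK.
Qed.

Lemma thetaM_21 k r t : thetaM (k.+2 :: r) (1%N :: t) = 0.
Proof.
rewrite thetaM_cons big_deconcat_cons /= !mul0r add0r big1 // => p _.
by rewrite !mul0r.
Qed.

(** Here the first block is longer than its initial letter 1, and nu(1.u) = nu(u) for nonempty u. *)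
Lemma thetaM_12 k r t :
  thetaM (1%N :: r) (k.+2 :: t) = thetaM r (k.+1 :: t).
Proof.
rewrite !thetaM_cons big_deconcat_cons /= !mul0r add0r; apply: eq_bigr => p _.
rewrite add1n eqSS; case: p.1 => [|a u]; first by rewrite !mul0r.
by rewrite expr1 mulN1r opprK add0r.
Qed.

(** The signs in nu(1.(a+1).u) and nu((a+2).u) are opposite, so their sum is 2 for empty u and 0
    otherwise: only a block consisting of a single letter survives. *)
Lemma thetaM_merge k a r t :
  thetaM (1%N :: a.+1 :: r) (k.+2 :: t) + thetaM (a.+2 :: r) (k.+2 :: t) =
  2 * ((a == k)%:R * thetaM r t).
Proof.
rewrite thetaM_12 !thetaM_cons !big_deconcat_cons /= !mul0r !add0r.
rewrite -big_split -(deconcat_nil (fun p => 2 * ((a == k)%:R * thetaM p.2 t))).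
apply: eq_bigr => p _; rewrite /= !addSn !eqSS !exprS.
move: (thetaM p.2 t) => x; case: p.1 => [|b u] /=; last by ring.
by rewrite addn0; ring.
Qed.

(* As [thetaM], but the first block of r must be a single letter and is not
   weighted by [nu]; this makes the recursion on bit sequences close up. *)
Definition zetaM (r t : seq nat) : K :=
  (head 0%N r == head 0%N t)%:R * thetaM (behead r) (behead t).

(** The coefficient at M of [bitcomp t] of theta(F_D), D = [bitset d], according to the formula for
    theta on M; F_D is the sum of the M_r over all r above D. *)
Definition thetaF (d t : bitseq) : K :=
  \sum_(b <- bitseqs (size d) | bitle d b) thetaM (bitcomp b) (bitcomp t).

Definition zetaF (d t : bitseq) : K :=
  \sum_(b <- bitseqs (size d) | bitle d b) zetaM (bitcomp b) (bitcomp t).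

Lemma big_bitle_cons (F : bitseq -> K) c d :
  \sum_(b <- bitseqs (size d).+1 | bitle (c :: d) b) F b =
  \sum_(b <- bitseqs (size d) | bitle d b) F (true :: b) +
  (if c then 0 else \sum_(b <- bitseqs (size d) | bitle d b) F (false :: b)).
Proof.
rewrite big_cat !big_map /=; congr (_ + _); first by case: c.
by case: c => //; rewrite big_pred0.
Qed.

Lemma bitcomp_split b : exists k q, bitcomp b = k.+1 :: q /\ all (leq 1) q.
Proof.
have := bitcomp_pos b; rewrite bitcomp_neq0 /=.
by case: (head 0%N _) => // k /= qpos; exists k, (behead (bitcomp b)).
Qed.

Lemma thetaF_nil : thetaF [::] [::] = 2.
Proof. by rewrite /thetaF big_cons big_nil addr0 thetaM_11 // mulr1. Qed.

Lemma thetaF_cons1 c d t : thetaF (c :: d) (true :: t) = 2 * thetaF d t.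
Proof.
rewrite /thetaF big_bitle_cons [if c then _ else _](_ : _ = 0) ?addr0.
  by rewrite mulr_sumr; apply: eq_bigr => b _; rewrite thetaM_11 ?bitcomp_pos.
case: c => //; rewrite big1 // => b _ /=.
by have [k [q [-> _]]] := bitcomp_split b; rewrite thetaM_21.
Qed.

Lemma thetaF_10 d t : thetaF (true :: d) (false :: t) = thetaF d t.
Proof.
rewrite /thetaF big_bitle_cons addr0; apply: eq_bigr => b _ /=.
by have [k [q [-> _]]] := bitcomp_split t; rewrite thetaM_12.
Qed.

(** The first bit above d is free; its two values are paired, and [thetaM_merge] leaves a single
    unweighted letter as first block, which is what [zetaF] describes. *)
Lemma thetaF_00 d t : thetaF (false :: d) (false :: t) = 2 * zetaF d t.
Proof.
rewrite /thetaF /zetaF big_bitle_cons -big_split mulr_sumr.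
apply: eq_bigr => b _ /=.
have [k [q [-> _]]] := bitcomp_split t; have [a [r [-> _]]] := bitcomp_split b.
exact: thetaM_merge.
Qed.

Lemma zetaF_nil : zetaF [::] [::] = 1.
Proof. by rewrite /zetaF big_cons big_nil addr0 /zetaM /= mulr1. Qed.

Lemma zetaF_cons1 c d t : zetaF (c :: d) (true :: t) = thetaF d t.
Proof.
rewrite /zetaF /zetaM big_bitle_cons [if c then _ else _](_ : _ = 0) ?addr0.
  by apply: eq_bigr => b _ /=; rewrite mul1r.
case: c => //; rewrite big1 // => b _ /=.
by have [k [q [-> _]]] := bitcomp_split b; rewrite mul0r.
Qed.

Lemma zetaF_10 d t : zetaF (true :: d) (false :: t) = 0.
Proof.
rewrite /zetaF /zetaM big_bitle_cons addr0 big1 // => b _ /=.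
by have [k [q [-> _]]] := bitcomp_split t; rewrite mul0r.
Qed.

Lemma zetaF_00 d t : zetaF (false :: d) (false :: t) = zetaF d t.
Proof.
rewrite /zetaF /zetaM big_bitle_cons big1 ?add0r //= => b _.
by have [k [q [-> _]]] := bitcomp_split t; rewrite mul0r.
Qed.

(* The weight 2 ^ #peaks of d times the indicator of the condition that e
   changes at every peak of d; c and a are the letters preceding d and e. *)
Fixpoint weight (c a : bool) (d e : bitseq) : K :=
  match d, e with
  | c' :: d', a' :: e' =>
    (if ~~ c && c' then 2 * (a != a')%:R else 1) * weight c' a' d' e'
  | _, _ => 1
  end.

Definition weightsum (c a : bool) (d t : bitseq) : K :=
  \sum_(e <- bitseqs (size t) | bitle e t) weight c a d e.

Lemma big_bitge_cons (F : bitseq -> K) c t :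
  \sum_(b <- bitseqs (size t).+1 | bitle b (c :: t)) F b =
  (if c then \sum_(b <- bitseqs (size t) | bitle b t) F (true :: b) else 0) +
  \sum_(b <- bitseqs (size t) | bitle b t) F (false :: b).
Proof.
rewrite big_cat !big_map /=; congr (_ + _).
by case: c => //; rewrite big_pred0.
Qed.

(** Three equations close the induction. After a descent the next letter of d is no peak, so the
    letter a is irrelevant; after a non-descent it matters, and both the value for a = [false] and
    the sum over a are needed. The factor 2 stays on the left because K is only a ring. *)
Lemma weightsum_thetaF d t : size d = size t ->
  [/\ forall a, 2 * weightsum true a d t = thetaF d t,
      weightsum false false d t = zetaF d t &
      weightsum false false d t + weightsum false true d t = thetaF d t].
Proof.
have wsE c a c' d' b t' : weightsum c a (c' :: d') (b :: t') =
    (if b then (if ~~ c && c' then 2 * (a != true)%:R else 1) *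
      weightsum c' true d' t' else 0) +
    (if ~~ c && c' then 2 * (a != false)%:R else 1) *
      weightsum c' false d' t'.
  rewrite /weightsum big_bitge_cons /= !mulr_sumr.
  by case: b.
elim: d t => [|c d IHd] [|b t] // => [_|[/IHd[IH1 IH2 IH3]]].
  rewrite /weightsum !big_cons !big_nil /= !addr0 thetaF_nil zetaF_nil.
  by split => // a; rewrite mulr1.
have simp := (mulr1, mulr0, mul0r, mul1r, add0r, addr0).
split=> [a||]; rewrite !wsE.
- case: c; case: b; rewrite /= ?thetaF_cons1 ?thetaF_10 ?thetaF_00 ?simp
    ?mulrDr ?IH1 -?IH3 -?IH2; ring.
- case: c; case: b; rewrite /= ?zetaF_cons1 ?zetaF_10 ?zetaF_00 ?simp
    ?IH1 -?IH3 -?IH2; ring.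
case: c; case: b; rewrite /= ?thetaF_cons1 ?thetaF_10 ?thetaF_00 ?simp
  ?IH1 -?IH3 -?IH2; ring.
Qed.

End ThetaFundamental.

(** * From weights of bit sequences to peak sets and symmetric differences *)

Section PeakWeight.
Variable K : comNzRingType.

Fixpoint peakbits (c : bool) (d : bitseq) : bitseq :=
  if d is c' :: d' then (~~ c && c') :: peakbits c' d' else [::].

Fixpoint diffbits (a : bool) (e : bitseq) : bitseq :=
  if e is a' :: e' then (a != a') :: diffbits a' e' else [::].

Lemma size_peakbits c d : size (peakbits c d) = size d.
Proof. by elim: d c => //= c' d IHd c; rewrite IHd. Qed.

Lemma size_diffbits a e : size (diffbits a e) = size e.
Proof. by elim: e a => //= a' e IHe a; rewrite IHe. Qed.

Lemma nth_peakbits c d i :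
  nth false (peakbits c d) i = ~~ nth true (c :: d) i && nth false d i.
Proof.
by elim: d c i => [|c' d IHd] c [|i] //=; rewrite ?nth_nil ?andbF // IHd.
Qed.

Lemma nth_diffbits a e i : (i < size e)%N ->
  nth false (diffbits a e) i = (nth false (a :: e) i != nth false e i).
Proof. by elim: e a i => [|a' e IHe] a [|i] //= ie; rewrite IHe. Qed.

Lemma weightE c a d e : size d = size e -> weight K c a d e =
  (2 ^ count id (peakbits c d))%:R * (bitle (peakbits c d) (diffbits a e))%:R.
Proof.
elim: d c a e => [|c' d IHd] c a [|a' e] //= => [_|[/IHd IH]]; first by rewrite mulr1.
rewrite IH; case: (~~ c && c'); case: (a != a'); rewrite /= ?mul1r //.
  by rewrite mulr1 mulrA -natrM -expnS.
by rewrite mulr0 mul0r mulr0.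
Qed.

Lemma in_shift1 i D : (i \in shift1 D) = (0 < i)%N && (i.-1 \in D).
Proof.
apply/imfsetP/andP => [[j /= jD ->] //|[i0 iD]].
by exists i.-1 => //; rewrite prednK.
Qed.

(** The virtual letter [true] in front of d prevents 1 from being a peak, in accordance with 0 not
    being in the set shifted by [peak_part]. *)
Lemma bitset_peakbits d :
  bitset (peakbits true d) = peak_part (size d).+1 (bitset d).
Proof.
apply/fsetP => i; rewrite in_fsetI in_shift1 in_fsetD in_zint !in_bitset nth_peakbits /=.
case: i => [|[|i]] //=; first by rewrite andbF.
case: (leqP i.+1 (size d)) => [id|di]; last first.
  by rewrite (@nth_default _ false d i.+1) ?andbF // ltnW.
by rewrite (set_nth_default false) // andbT andbC.
Qed.

(** The virtual letter [false] says that 0 is not in the set. The bound on i matters, as the shifted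
    set may contain one further element. *)
Lemma symdiff_diffbits e i : (0 < i <= size e)%N ->
  (i \in symdiff (bitset e) (shift1 (bitset e))) = (i \in bitset (diffbits false e)).
Proof.
case: i => // i /= ie; rewrite in_fsetU !in_fsetD !in_shift1 !in_bitset /= nth_diffbits //.
case: i ie => [|i] ie //=; first by case: nth.
by case: (nth _ e i.+1); case: (nth _ e i).
Qed.

Lemma weight_peak_part d e : size d = size e ->
  let P := peak_part (size d).+1 (bitset d) in
  weight K true false d e = (2 ^ size P)%:R *
    (P `<=` symdiff (bitset e) (shift1 (bitset e)))%fset%:R.
Proof.
move=> sde P; rewrite weightE // /P -bitset_peakbits card_bitset bitleE; last first.
  by rewrite size_peakbits size_diffbits.
congr (_ * _%:R); congr nat_of_bool.
apply/fsubsetP/fsubsetP => sub i ip; have := sub i ip;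
  rewrite symdiff_diffbits //; have := fsubsetP (bitset_sub _) i ip;
  by rewrite in_zint size_peakbits sde.
Qed.

Lemma thetaM_fundamental d t : size d = size t ->
  let P := peak_part (size d).+1 (bitset d) in
  (2 ^ (size P).+1)%:R *
  (\sum_(D <- fpowerset (zint 1 (size d)) |
       (P `<=` symdiff D (shift1 D))%fset) (D `<=` bitset t)%fset%:R) =
  \sum_(r <- comps (size d).+1 | (bitset d `<=` Dset r)%fset)
    thetaM K r (bitcomp t).
Proof.
move=> sdt P; rewrite (perm_big _ (perm_fpowerset _)) !big_map /=.
transitivity (thetaF K d t); last first.
  rewrite /thetaF big_seq_cond [RHS]big_seq_cond; apply: eq_bigl => b.
  rewrite mem_bitseqs; case: eqP => //= sb.
  by rewrite bitleE // Dset_bitcomp.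
(* The initial state is a virtual descent in d and a virtual non-descent in e. The factor 2 of this
   equation accounts for the successor in the exponent of 2. *)
have [/(_ false) <- _ _] := weightsum_thetaF K sdt.
rewrite expnS natrM -mulrA; congr (_ * _); rewrite /weightsum -sdt mulr_sumr.
rewrite big_seq_cond [RHS]big_seq_cond big_mkcond [RHS]big_mkcond.
apply: eq_bigr => e _; rewrite mem_bitseqs; case: eqP => //= se.
rewrite weight_peak_part // bitleE ?se // -/P.
by case: ifP; case: ifP; rewrite ?mulr1 ?mulr0.
Qed.

End PeakWeight.

(** * Quasi-symmetric functions as functions of the exponent sequence *)

Definition msupp (m : {cmonom nat}) : seq nat := sort leq (finsupp m).

(** A quasi-symmetric function depends on a monomial only through this sequence, so computations in
    Qsym become computations with functions of words. *)
Definition exps (m : {cmonom nat}) : seq nat := map m (msupp m).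

Lemma mem_msupp (m : {cmonom nat}) x : (x \in msupp m) = (0 < m x)%N.
Proof. by rewrite mem_sort -cmE_neq0 lt0n. Qed.

Lemma msupp_sorted m : sorted ltn (msupp m).
Proof. by rewrite ltn_sorted_uniq_leq sort_uniq fset_uniq sort_sorted //; apply: leq_total. Qed.

Lemma exps_pos m : all (leq 1) (exps m).
Proof. by apply/allP => k /mapP[x + ->]; rewrite mem_msupp. Qed.

Lemma mon_cons i s k a x : mon (i :: s) (k :: a) x = ((i == x) * k + mon s a x)%N.
Proof.
rewrite /mon /= mulcmE; congr addn; rewrite /expcmn.
case: k => [|k]; first by rewrite onecmE muln0.
rewrite iteropS; elim: k => [|k IHk] /=; first by rewrite ucmE muln1.
by rewrite mulcmE IHk ucmE -mulnS.
Qed.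

Lemma mon_nth s a x : uniq s -> size a = size s -> mon s a x = nth 0%N a (index x s).
Proof.
elim: s a => [|i s IHs] [|k a] //=; first by rewrite /mon /= onecmE.
move=> /andP[is_ us] [sas]; rewrite mon_cons IHs //; case: eqVneq => [ix|] //=.
by rewrite mul1n nth_default ?addn0 // sas leqNgt index_mem -ix.
Qed.

Lemma map_mon s a : uniq s -> size a = size s -> map (mon s a) s = a.
Proof.
move=> us sas; apply: (@eq_from_nth _ 0%N); rewrite size_map // => j js.
by rewrite (nth_map 0%N) // mon_nth // index_uniq.
Qed.

Lemma msupp_mon s a : sorted ltn s -> size a = size s ->
  msupp (mon s a) = [seq x <- s | (0 < mon s a x)%N].
Proof.
move=> ss sas; have us : uniq s by move: ss; rewrite ltn_sorted_uniq_leq => /andP[].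
apply: (irr_sorted_eq ltn_trans ltnn); first exact: msupp_sorted.
  exact: (sorted_filter ltn_trans).
move=> x; rewrite mem_msupp mem_filter andb_idr //.
rewrite mon_nth // -index_mem -sas.
by case: (leqP (size a) (index x s)) => // /(nth_default 0%N) ->.
Qed.

Lemma exps_mon s a : sorted ltn s -> size a = size s ->
  exps (mon s a) = nz a.
Proof.
move=> ss sas; have us : uniq s by move: ss; rewrite ltn_sorted_uniq_leq => /andP[].
rewrite /exps msupp_mon //; rewrite -[in RHS](map_mon us sas) filter_map.
by congr map; apply: eq_filter.
Qed.

Lemma mon_exps m : mon (msupp m) (exps m) = m.
Proof.
apply/eqP/cmP => x; rewrite mon_nth ?sort_uniq ?fset_uniq ?size_map //.
case: (boolP (x \in msupp m)) => xm.
  by rewrite (nth_map 0%N) ?index_mem // nth_index.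
rewrite nth_default; first by move: xm; rewrite mem_msupp -eqn0Ngt => /eqP.
by rewrite size_map leqNgt index_mem.
Qed.

Lemma nz_id a : all (leq 1) a -> nz a = a.
Proof. by move/all_filterP. Qed.

Lemma mem_splits t p : reflect
  [/\ size p.1 = size t, size p.2 = size t &
      forall i, (nth 0 p.1 i + nth 0 p.2 i = nth 0 t i)%N]
  (p \in splits t).
Proof.
apply: (iffP idP).
  elim: t p => [|k t IHt] p; first by rewrite inE => /eqP -> /=; split => // i; rewrite nth_nil.
  rewrite [splits _]/splits -/splits => /allpairsP[[j q] [+ /IHt[q1 q2 qt] ->]].
  rewrite -[fst _]/j mem_iota add0n ltnS => jk.
  by split=> [||[|i]] /=; rewrite ?q1 ?q2 ?subnKC.
elim: t p => [|k t IHt] [[|a p1] [|b p2]] [] //= [s1] [s2] pt.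
rewrite [splits _]/splits -/splits; apply/allpairsP; exists (a, (p1, p2)).
have ab := pt 0%N; rewrite /= in ab; split.
- by change (a \in iota 0 k.+1); rewrite mem_iota; lia.
- by apply: IHt; split => // i; apply: (pt i.+1).
by rewrite /=; congr (_ , _ :: _); lia.
Qed.

Lemma splits_uniq t : uniq (splits t).
Proof.
elim: t => // k t IHt; rewrite [splits _]/splits -/splits.
by apply: allpairs_uniq => //; [exact: iota_uniq | move=> [? [? ?]] [? [? ?]] _ _ [-> -> _ ->]].
Qed.

Section Series.
Variable K : fieldType.
Local Notation Mon := (@Mon K).

Lemma MonE r m : all (leq 1) r -> Mon r m = (exps m == r)%:R.
Proof.
move=> rpos; rewrite /Defs.Mon; have [er|ner] := eqVneq (exps m) r.
  rewrite (_ : [set _ | _] = [set msupp m]) ?fsbig_set1 //.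
  apply/seteqP; split=> [i /= [si ss mi]|_ ->] /=.
    have := msupp_mon ss (esym si); rewrite mi => ->.
    apply/esym/all_filterP; apply/allP => x xi.
    rewrite -mi mon_nth //; last by move: ss; rewrite ltn_sorted_uniq_leq => /andP[].
    by apply: (allP rpos); rewrite mem_nth // -si index_mem.
  split; first by rewrite -er size_map.
    exact: msupp_sorted.
  by rewrite -er mon_exps.
rewrite (_ : [set _ | _] = set0) ?fsbig_set0 //.
apply/seteqP; split=> [i /= [si ss mi]|] //.
by case/eqP: ner; rewrite -mi exps_mon // nz_id.
Qed.

(** Factors of m involve only variables of m, so a factorisation is a splitting of the exponents
    along [msupp m], possibly with zeros. *)
Lemma series_mul_splits (f g : series K) m : series_mul f g m =
  \sum_(p <- splits (exps m)) f (mon (msupp m) p.1) * g (mon (msupp m) p.2).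
Proof.
set s := msupp m; set t := exps m.
have us : uniq s by rewrite sort_uniq fset_uniq.
have st : size t = size s by rewrite size_map.
pose F (p : seq nat * seq nat) := (mon s p.1, mon s p.2).
rewrite /series_mul (@fsum_seq _ K^o _ _ (map F (splits t))).
- by rewrite big_map.
- rewrite map_inj_in_uniq ?splits_uniq // => -[a b] [c d] /mem_splits[a1 b1 _].
  move=> /mem_splits[c1 d1 _]; rewrite /= in a1 b1 c1 d1.
  case=> eac ebd; rewrite st in a1 b1 c1 d1.
  by rewrite -(map_mon us a1) -(map_mon us b1) eac ebd !map_mon.
- move=> _ /mapP[p /mem_splits[p1 p2 pt] ->] /=.
  rewrite -[RHS]mon_exps; apply/eqP/cmP => x.
  by rewrite mulcmE !mon_nth ?p1 ?p2.
move=> [m1 m2] /= m12 _; apply/mapP; exists (map m1 s, map m2 s).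
  apply/mem_splits; split; rewrite /= ?size_map // => i.
  case: (ltnP i (size s)) => si; last by rewrite !nth_default ?size_map.
  by rewrite !(nth_map 0%N) // -mulcmE m12.
have ms m3 m4 : mulcm m3 m4 = m -> mon s (map m3 s) = m3.
  move=> m34; apply/eqP/cmP => x; rewrite mon_nth ?size_map //.
  case: (boolP (x \in s)) => xs; first by rewrite (nth_map 0%N) ?index_mem // nth_index.
  rewrite nth_default; last by rewrite size_map leqNgt index_mem.
  by move: xs; rewrite mem_msupp -m34 mulcmE addn_gt0 negb_or -!eqn0Ngt => /andP[/eqP].
by rewrite /F /= (ms _ _ m12) (ms m2 m1) // mulcmC.
Qed.

(** Exponents 0 in a factor are invisible to [exps], whence the filters. *)
Lemma series_mulE (g h : seq nat -> K^o) m :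
  series_mul (g \o exps) (h \o exps) m =
  \sum_(p <- splits (exps m)) g (nz p.1) * h (nz p.2).
Proof.
rewrite series_mul_splits; apply: eq_big_seq => p /mem_splits[p1 p2 _] /=.
by rewrite !exps_mon ?p1 ?p2 ?size_map //; apply: msupp_sorted.
Qed.

Lemma series_mul_linearl (g : series K) :
  linear_on setT (fun f : series K => series_mul f g : series K).
Proof.
move=> a f f' _ _; apply: funext => m.
change (series_mul (a *: f + f') g m = a * series_mul f g m + series_mul f' g m).
rewrite !series_mul_splits mulr_sumr -big_split; apply: eq_bigr => p _.
by rewrite /= mulrA -mulrDl.
Qed.

Lemma series_mul_linearr (f : series K) :
  linear_on setT (fun g : series K => series_mul f g : series K).
Proof.
move=> a g g' _ _; apply: funext => m.
change (series_mul f (a *: g + g') m = a * series_mul f g m + series_mul f g' m).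
rewrite !series_mul_splits mulr_sumr -big_split; apply: eq_bigr => p _.
by rewrite /= mulrCA -mulrDr.
Qed.

End Series.

(** * Permutations with a given descent set *)

Lemma img_ord n (s : 'S_n) i (ni : (i < n)%N) :
  img s i.+1 = (s (Ordinal ni)).+1.
Proof. by rewrite /img /= insubT. Qed.

Lemma in_Des n (s : 'S_n) i :
  (i \in Des s) = (1 <= i <= n.-1)%N && (img s i.+1 < img s i)%N.
Proof. by rewrite -in_zint !inE. Qed.

Section DescentSet.
Variables (n : nat) (D : {fset nat}).

Let block (j : nat) : nat := count (fun d => d <= j)%N D.

(** The order of the values to be assigned to the places: later blocks receive smaller values, and
    values increase within a block. Hence descents occur exactly at the block ends, the elements of
    D; [rank] counts the places with smaller value. *)
Let before (k j : nat) : bool :=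
  (block j < block k)%N || (block k == block j) && (k < j)%N.

Let beforexx j : before j j = false.
Proof. by rewrite /before !ltnn andbF. Qed.

Let before_trans : transitive before.
Proof. by move=> k j l; rewrite /before; lia. Qed.

Let before_total j k : j != k -> before j k || before k j.
Proof. by rewrite /before; lia. Qed.

Let rank (j : 'I_n) : nat := #|[pred k : 'I_n | before k j]|.

Let rank_lt j : (rank j < n)%N.
Proof.
rewrite -[X in (_ < X)%N]card_ord; apply: proper_card.
by apply/properP; split; [exact/fintype.subsetP | exists j; rewrite !inE ?beforexx].
Qed.

Let before_rank (j k : 'I_n) : before j k -> (rank j < rank k)%N.
Proof.
move=> bjk; apply: proper_card; apply/properP; split.
  by apply/fintype.subsetP => l; rewrite !inE => /before_trans; apply.
by exists j; rewrite !inE ?beforexx.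
Qed.

Let rank_before (j k : 'I_n) : (rank j < rank k)%N = before j k.
Proof.
apply/idP/idP => [|/before_rank //]; case: (eqVneq (j : nat) k) => [/val_inj ->|].
  by rewrite ltnn.
by case/before_total/orP => // /before_rank; lia.
Qed.

Let rank_inj : injective (fun j => Ordinal (rank_lt j)).
Proof.
move=> j k [] ejk; apply/val_inj/eqP; apply/negPn/negP => /before_total.
by rewrite -!rank_before ejk ltnn.
Qed.

Let block_step j : block j.+1 = (block j + (j.+1 \in D))%N.
Proof.
rewrite /block -(count_uniq_mem _ (fset_uniq D)) -count_predUI.
rewrite [X in (_ = _ + X)%N](_ : _ = 0%N) ?addn0.
  by apply: eq_count => d /=; rewrite leq_eqVlt ltnS orbC.
by rewrite -(count_pred0 D); apply: eq_count => d /=; case: eqP => [->|]; rewrite ?ltnn ?andbF.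
Qed.

Lemma Des_surj : (D `<=` zint 1 n.-1)%fset -> exists s : 'S_n, Des s = D.
Proof.
move=> /fsubsetP Dn; exists (perm rank_inj); apply/fsetP => i.
rewrite in_Des; case: (boolP (_ <= _ <= _)%N) => [/andP[i0 iltn]|ni] /=; last first.
  by apply/esym/negbTE; apply: contra ni => /Dn; rewrite in_zint.
case: i i0 iltn => // i _ iltn; have {iltn} ni : (i.+1 < n)%N by lia.
rewrite (img_ord _ ni) (img_ord _ (ltnW ni)) !permE /= ltnS rank_before.
by rewrite /before /= block_step; case: (i.+1 \in D); lia.
Qed.

End DescentSet.

Lemma in_Peak n (s : 'S_n) i : (i \in Peak s) =
  (2 <= i <= n.-1)%N && ((img s i.-1 < img s i)%N && (img s i.+1 < img s i)%N).
Proof. by rewrite -in_zint !inE. Qed.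

Lemma Des_sub n (s : 'S_n) : (Des s `<=` zint 1 n.-1)%fset.
Proof. by apply/fsubsetP => i; rewrite in_Des in_zint => /andP[]. Qed.

Lemma PeakE n (s : 'S_n) : Peak s = peak_part n (Des s).
Proof.
apply/fsetP => i; rewrite in_Peak in_fsetI in_shift1 in_fsetD in_zint !in_Des.
case: i => [|[|i]] //=; first by rewrite andbF.
case: (leqP i.+2 n.-1) => //= ni; rewrite (ltnW ni) /= andbT.
have n0 : (i.+2 < n)%N by lia.
rewrite (img_ord _ (ltnW n0)) (img_ord _ (ltnW (ltnW n0))) -leqNgt andbC.
(* By injectivity a non-descent is a strict ascent. *)
congr andb; rewrite !ltnS ltn_neqAle; apply/andb_idl => _.
apply/negP => /eqP/val_inj/perm_inj/(congr1 val) /= ; lia.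
Qed.

Lemma peak_part_peak_set n D : (D `<=` zint 1 n.-1)%fset ->
  peak_set n (peak_part n D).
Proof.
move=> /fsubsetP Dn; apply/andP; split.
  apply/fsubsetP => i; rewrite in_fsetI in_shift1 in_fsetD !in_zint.
  by case/andP=> /Dn; rewrite in_zint => /andP[_ ?] /and3P[_ _ /andP[? _]]; lia.
apply/eqP/fsetP => i; rewrite in_fset0 in_fsetI; apply/negbTE/negP.
rewrite !(in_fsetI, in_shift1, in_fsetD) => /andP[/andP[iD _] /imfsetP[j /=]].
rewrite !(in_fsetI, in_shift1, in_fsetD) => /andP[_ /and3P[_ jD _]] ij.
by rewrite -ij iD in jD.
Qed.

(** No two elements of P are adjacent, so each of them is preceded by a non-descent. Reading a peak
    set as a descent set therefore gives canonical permutations and words with that peak set. *)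
Lemma peak_part_id n P : peak_set n P -> peak_part n P = P.
Proof.
move=> /andP[/fsubsetP Pn /eqP P1]; apply/fsetP => i.
rewrite in_fsetI in_shift1 in_fsetD in_zint; apply/andb_idr => iP.
have := Pn _ iP; rewrite in_zint => /andP[i2 ilt].
apply/and3P; split; [by lia| |by lia].
apply/negP => i1P; have : i.-1 \in fset0 by rewrite -P1 in_fsetI i1P; apply/imfsetP; exists i.
by rewrite in_fset0.
Qed.

Lemma peak_set_sub n P : peak_set n P -> (P `<=` zint 1 n.-1)%fset.
Proof.
move=> /andP[/fsubsetP Pn _]; apply/fsubsetP => i /Pn; rewrite !in_zint; lia.
Qed.

Section PermVectors.
Variable K : fieldType.

Lemma sum_permvec (Q : forall n, 'S_n -> bool) n (t : perms) :
  (\sum_(s : 'S_n | Q n s) permvec K s) t =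
  ((tag t == n) && Q (tag t) (tagged t))%:R.
Proof.
rewrite fct_sumE; case: t => m u /=; case: (eqVneq m n) => [mn|mn] /=; last first.
  by rewrite big1 // => s _; rewrite /permvec -tag_eqE /tag_eq /= (negbTE mn).
subst m; have permE s : permvec K s (existT _ n u) = (u == s)%:R.
  by rewrite /permvec -[existT _ _ _]/(Tagged (fun m => 'S_m) u) eq_Tagged.
under eq_bigr do rewrite permE.
rewrite big_mkcond (bigD1 u) //= eqxx big1 ?addr0; first by case: (Q n u).
by move=> s; rewrite eq_sym => /negbTE ->; case: ifP.
Qed.

Lemma DeltaE n D (t : perms) :
  Delta K n D t = ((tag t == n) && (Des (tagged t) == D))%:R.
Proof. exact: (sum_permvec (fun m s => Des s == D)). Qed.

Lemma PiE x (t : perms) :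
  Pi K x t = ((tag t == x.1) && (Peak (tagged t) == x.2))%:R.
Proof. exact: (sum_permvec (fun m s => Peak s == x.2)). Qed.

Lemma XiE n D (t : perms) :
  Xi K n D t = ((tag t == n) && (Des (tagged t) `<=` D)%fset)%:R.
Proof.
rewrite /Xi fct_sumE; under eq_bigr do rewrite DeltaE.
case: eqP => /= _; last by rewrite big1.
case: (boolP (_ `<=` D)%fset) => sub.
  rewrite (bigD1_seq (Des (tagged t))) ?fset_uniq ?fpowersetE //= eqxx big1 ?addr0 //.
  by move=> E; rewrite eq_sym => /negbTE ->.
rewrite big1_seq // => E /=; rewrite fpowersetE; case: eqP => // <- sub'.
by rewrite sub' in sub.
Qed.

End PermVectors.

(** * The bases *)

Lemma sum_indicator (R : pzSemiRingType) (J : eqType) (s : seq J) (P : pred J) j0 :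
  uniq s -> j0 \in s -> \sum_(j <- s | P j) (j0 == j)%:R = (P j0)%:R :> R.
Proof.
move=> us js; rewrite big_mkcond (bigD1_seq j0) //= eqxx big1 ?addr0.
  by case: (P j0).
by move=> j; rewrite eq_sym => /negbTE ->; case: ifP.
Qed.

(** Inversion of a unitriangular change of basis without its signs: all terms of [b' i] other than
    [b i] have smaller rank and are in the span by induction. *)
Lemma triangular_span (K : fieldType) (I : choiceType) (V : lmodType K)
    (A : set I) (b b' : I -> V) (l : I -> seq I) (rank : I -> nat) :
  (forall i, A i -> b' i = \sum_(j <- l i) b j) ->
  (forall i, A i -> uniq (l i) /\ i \in l i) ->
  (forall i j, A i -> j \in l i -> A j /\ (j != i -> (rank j < rank i)%N)) ->
  forall i, A i -> span A b' (b i).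
Proof.
move=> b'E lu lA i; have [n] := ubnP (rank i); elim: n i => // n IHn i.
rewrite ltnS => rn Ai; have [ul il] := lu i Ai.
have -> : b i = b' i - \sum_(j <- l i | j != i) b j.
  by rewrite b'E // (bigD1_seq i) //= addrK.
apply: (subspaceB (span_subspace A b')); first exact: span_basis.
apply: (subspace_sum (span_subspace A b')) => j jl ji.
have [Aj rj] := lA i j Ai jl; apply: IHn => //.
exact: leq_trans (rj ji) rn.
Qed.

Definition descperms (x : nat * {fset nat}) : set {n : nat & 'S_n} :=
  [set t | tag t = x.1 /\ Des (tagged t) = x.2].

Definition descperm (x : nat * {fset nat}) : perms :=
  xget (Tagged (fun n => 'S_n) (1%g : 'S_0)) (descperms x).

Lemma descpermP x : (x.2 `<=` zint 1 x.1.-1)%fset ->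
  tag (descperm x) = x.1 /\ Des (tagged (descperm x)) = x.2.
Proof.
move=> /(@Des_surj x.1)[s sx]; apply: (@xgetPex _ _ (descperms x)).
by exists (Tagged (fun n => 'S_n) s).
Qed.

Definition desccomp (x : nat * {fset nat}) : seq nat :=
  xget [::] [set q | [/\ all (leq 1) q, sumn q = x.1 & Dset q = x.2]].

Lemma desccompP x : (x.2 `<=` zint 1 x.1.-1)%fset ->
  [/\ all (leq 1) (desccomp x), sumn (desccomp x) = x.1 & Dset (desccomp x) = x.2].
Proof.
move=> /Dset_surj ex.
exact: (@xgetPex _ [::] [set q | [/\ all (leq 1) q, sumn q = x.1 & Dset q = x.2]]).
Qed.

Definition mono (t : seq nat) : {cmonom nat} := mon (iota 0 (size t)) t.

Lemma exps_mono t : all (leq 1) t -> exps (mono t) = t.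
Proof. by move=> tpos; rewrite exps_mon ?size_iota ?nz_id ?iota_ltn_sorted. Qed.

Lemma card_Dset q : all (leq 1) q -> (size (Dset q) <= sumn q)%N.
Proof.
move=> /Dset_sub/fsubset_leq_card/leq_trans; apply.
have -> : zint 1 (sumn q).-1 = bitset (nseq (sumn q).-1 true).
  apply/fsetP => i; rewrite in_zint in_bitset nth_nseq.
  by case: i => // i /=; case: ifP.
by rewrite card_bitset count_nseq mul1n leq_pred.
Qed.

Section Bases.
Variable K : fieldType.

Lemma FundM n D : Fund K n D =
  \sum_(r <- comps n | (D `<=` Dset r)%fset) Mon K r.
Proof.
rewrite /Fund -[RHS]big_filter; apply: fsum_seq.
- by rewrite filter_uniq ?comps_uniq.
- by move=> r; rewrite mem_filter mem_comps => /and3P[Dr rpos /eqP].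
by move=> r [rpos rn Dr] _; rewrite mem_filter mem_comps Dr rn eqxx andbT.
Qed.

Lemma FundE n D m :
  Fund K n D m = ((sumn (exps m) == n) && (D `<=` Dset (exps m))%fset)%:R.
Proof.
rewrite FundM fct_sumE big_seq_cond.
under eq_bigr => r rn.
  rewrite MonE; last by case/andP: rn; rewrite mem_comps => /andP[].
over.
rewrite -big_seq_cond; have := mem_comps n (exps m); rewrite exps_pos /= => mn.
case: (boolP (sumn (exps m) == n)) => nm; rewrite /=; last first.
  by rewrite big1_seq // => r /andP[_ rn]; case: eqP => // er; rewrite -mn er rn in nm.
by rewrite sum_indicator ?comps_uniq // mn.
Qed.

Lemma KstE x m : Kst K x m = (stembridge_factor x.1 x.2)%:R *
  \sum_(D <- fpowerset (zint 1 x.1.-1) | (x.2 `<=` symdiff D (shift1 D))%fset)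
    ((sumn (exps m) == x.1) && (D `<=` Dset (exps m))%fset)%:R.
Proof.
rewrite /Kst; transitivity ((stembridge_factor x.1 x.2)%:R *
  (\sum_(D <- fpowerset (zint 1 x.1.-1) | (x.2 `<=` symdiff D (shift1 D))%fset)
    Fund K x.1 D) m); first by [].
by rewrite fct_sumE; congr (_ * _); apply: eq_bigr => D _; rewrite FundE.
Qed.

Lemma compeqE q r : all (leq 1) q -> all (leq 1) r ->
  ((sumn q == sumn r) && (Dset q == Dset r)) = (q == r).
Proof.
move=> qpos rpos; apply/andP/eqP => [[/eqP sqr /eqP]|->]; last by [].
exact: Dset_inj.
Qed.

Definition wordperm (q : seq nat) : perms := descperm (sumn q, Dset q).

Lemma wordpermP q : all (leq 1) q ->
  tag (wordperm q) = sumn q /\ Des (tagged (wordperm q)) = Dset q.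
Proof. by move=> /Dset_sub Dq; exact (@descpermP (sumn q, Dset q) Dq). Qed.

Lemma Deltaw_word q r : all (leq 1) q -> all (leq 1) r ->
  Deltaw K q (wordperm r) = (r == q)%:R.
Proof.
move=> qpos rpos; rewrite /Deltaw DeltaE; have [tE dE] := wordpermP rpos.
by rewrite dE tE compeqE.
Qed.

Lemma Xiw_word q r : all (leq 1) r -> Xiw K q (wordperm r) =
  ((sumn r == sumn q) && (Dset r `<=` Dset q)%fset)%:R.
Proof. by move=> rpos; rewrite /Xiw XiE; have [tE dE] := wordpermP rpos; rewrite dE tE. Qed.

Lemma Fundw_word q t : all (leq 1) t -> Fundw K q (mono t) =
  ((sumn t == sumn q) && (Dset q `<=` Dset t)%fset)%:R.
Proof. by move=> tpos; rewrite /Fundw FundE exps_mono. Qed.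

Lemma Dset_ltn q r : all (leq 1) q -> all (leq 1) r ->
  (sumn q == sumn r) && (Dset q `<=` Dset r)%fset -> q != r ->
  (size (Dset q) < size (Dset r))%N.
Proof.
move=> qpos rpos /andP[sqr sub] qr; apply: fproper_ltn_card.
by rewrite fproperEneq sub andbT; apply: contraNneq qr => e; rewrite -compeqE // sqr e /=.
Qed.

Lemma Deltaw_independent : independent compositions (Deltaw K).
Proof.
apply: (@triangular_independent _ _ _ _ _ wordperm (fun=> 0%N)) => [q qpos|q r qpos rpos].
  by rewrite Deltaw_word // eqxx oner_eq0.
by move=> + qr; rewrite Deltaw_word // (negbTE qr) /= eqxx.
Qed.

Lemma Xiw_independent : independent compositions (Xiw K).
Proof.
(* Xi^q is nonzero at the words below q, so the rank has to decrease when the descent set grows. *)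
apply: (@triangular_independent _ _ _ _ _ wordperm
  (fun q => sumn q - size (Dset q))%N) => [q qpos|q r qpos rpos].
  by rewrite Xiw_word // eqxx fsubset_refl oner_eq0.
rewrite Xiw_word //; case: (boolP (_ && _)) => //= [qr _ neqr|]; last by rewrite eqxx.
have ltqr := Dset_ltn qpos rpos qr neqr; have := card_Dset rpos.
case/andP: qr => /eqP -> _ ler.
exact: ltn_sub2l (leq_trans ltqr ler) ltqr.
Qed.

Lemma Mon_independent : independent compositions (Mon K).
Proof.
apply: (@triangular_independent _ _ _ _ _ mono (fun=> 0%N)) => [q qpos|q r qpos rpos].
  by rewrite MonE // exps_mono // eqxx oner_eq0.
by move=> + qr; rewrite MonE // exps_mono // (negbTE qr) /= eqxx.
Qed.

Lemma Fundw_independent : independent compositions (Fundw K).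
Proof.
apply: (@triangular_independent _ _ _ _ _ mono (fun q => size (Dset q)))
  => [q qpos|q r qpos rpos].
  by rewrite Fundw_word // eqxx fsubset_refl oner_eq0.
rewrite Fundw_word //; case: (boolP (_ && _)) => //= [qr _ neqr|]; last by rewrite eqxx.
by apply: Dset_ltn; rewrite // eq_sym // [X in X && _]eq_sym.
Qed.

Lemma descent_vectorE n (Q : {fset nat} -> bool) (f : perms -> K^o) :
  (forall t, f t = ((tag t == n) && Q (Des (tagged t)))%:R) ->
  f = \sum_(r <- comps n | Q (Dset r)) Deltaw K r.
Proof.
move=> fE; apply: funext => t; rewrite fE fct_sumE.
have [r [rpos rn Dr]] := Dset_surj (Des_sub (tagged t)).
have rE : forall r', r' \in comps n ->
    Deltaw K r' t = ((tag t == n) && (r == r'))%:R.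
  move=> r'; rewrite mem_comps => /andP[r'pos /eqP r'n].
  by rewrite /Deltaw DeltaE r'n -(compeqE rpos r'pos) Dr rn r'n; case: eqP.
rewrite big_seq_cond; under eq_bigr => r' /andP[r'n _] do rewrite (rE _ r'n).
rewrite -big_seq_cond -Dr; case: eqP => /= [tq|_]; last by rewrite big1.
by rewrite sum_indicator ?comps_uniq // mem_comps rpos rn tq eqxx.
Qed.

Lemma XiwE q :
  Xiw K q = \sum_(r <- comps (sumn q) | (Dset r `<=` Dset q)%fset) Deltaw K r.
Proof.
by apply: (@descent_vectorE _ (fun D => D `<=` Dset q)%fset) => t; rewrite /Xiw XiE.
Qed.

Lemma Pi_descent x : Pi K x =
  \sum_(r <- comps x.1 | peak_part x.1 (Dset r) == x.2) Deltaw K r.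
Proof.
apply: (@descent_vectorE _ (fun D => peak_part x.1 D == x.2)) => t.
rewrite PiE PeakE; case: eqP => //=.
by move: (Des _) => D tx; rewrite -[in RHS]tx.
Qed.

Lemma Deltaw_span q : all (leq 1) q -> span compositions (Xiw K) (Deltaw K q).
Proof.
apply: (@triangular_span _ _ _ _ _ _
  (fun q => [seq r <- comps (sumn q) | (Dset r `<=` Dset q)%fset])
  (fun q => size (Dset q))) => [i ipos|i ipos|i j ipos].
- by rewrite big_filter XiwE.
- by rewrite filter_uniq ?comps_uniq // mem_filter mem_comps eqxx ipos fsubset_refl.
rewrite mem_filter mem_comps => /and3P[ij jpos sij]; split => // neij.
by apply: Dset_ltn; rewrite // sij.
Qed.

Lemma Mon_span q : all (leq 1) q -> span compositions (Fundw K) (Mon K q).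
Proof.
apply: (@triangular_span _ _ _ _ _ _
  (fun q => [seq r <- comps (sumn q) | (Dset q `<=` Dset r)%fset])
  (fun q => sumn q - size (Dset q))%N) => [i ipos|i ipos|i j ipos].
- by rewrite big_filter /Fundw FundM.
- by rewrite filter_uniq ?comps_uniq // mem_filter mem_comps eqxx ipos fsubset_refl.
rewrite mem_filter mem_comps => /and3P[ij jpos /eqP sij]; split => // neij.
have := @Dset_ltn i j ipos jpos; rewrite sij eqxx ij eq_sym neij => /(_ isT isT) ltij.
rewrite -sij; apply: ltn_sub2l (leq_trans ltij _) ltij; exact: card_Dset.
Qed.

Lemma descent_algebraE : descent_algebra K = span compositions (Xiw K).
Proof.
apply/seteqP; split; apply: span_min; try exact: span_subspace.
  exact: Deltaw_span.
move=> q qpos; rewrite XiwE // -big_filter.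
apply: (subspace_sum (span_subspace _ _)) => r.
by rewrite mem_filter mem_comps => /and3P[_ rpos _] _; apply: span_basis.
Qed.

Lemma QsymE : Qsym K = span compositions (Fundw K).
Proof.
apply/seteqP; split; apply: span_min; try exact: span_subspace.
  exact: Mon_span.
move=> q qpos; rewrite /Fundw FundM -big_filter.
apply: (subspace_sum (span_subspace _ _)) => r.
by rewrite mem_filter mem_comps => /and3P[_ rpos _] _; apply: span_basis.
Qed.

Lemma Pi_desc x y : peak_set x.1 x.2 -> peak_set y.1 y.2 ->
  Pi K x (descperm y) = (y == x)%:R.
Proof.
move=> px py; rewrite PiE PeakE.
have [tE dE] := descpermP (peak_set_sub py).
rewrite dE tE; by rewrite peak_part_id //; case: x y {px py} => [n P] [m Q].
Qed.

Lemma Pi_independent : independent peak_sets (Pi K).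
Proof.
apply: (@triangular_independent _ _ _ _ _ descperm (fun=> 0%N)) => [x px|x y px py].
  by rewrite Pi_desc // eqxx oner_eq0.
by move=> + xy; rewrite Pi_desc // (negbTE xy) /= eqxx.
Qed.

(** Moving each p outside Q to p - 1 embeds P into Q and does not decrease n - p. This is the order
    that makes the family [Kst] triangular. *)
Lemma peak_rank n P Q : peak_set n P -> peak_set n Q ->
  (P `<=` Q `|` shift1 Q)%fset -> P != Q ->
  (\sum_(p <- P) (n - p) < \sum_(q <- Q) (n - q))%N.
Proof.
move=> /andP[/fsubsetP Pn /eqP P1] /andP[/fsubsetP Qn _] /fsubsetP PQ neqPQ.
pose f p := if p \in Q then p else p.-1.
have fQ p : p \in P -> f p \in Q.
  move=> /PQ; rewrite in_fsetU in_shift1 /f; case: ifP => //= _ /andP[]//.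
have ltn_sum : (\sum_(q <- map f P) (n - q) <= \sum_(q <- Q) (n - q))%N.
  rewrite [X in (_ <= X)%N](bigID (mem (map f P))) /= -[X in (_ <= X + _)%N]big_filter.
  rewrite (perm_big [seq q <- Q | q \in map f P]) ?leq_addr //.
  apply: uniq_perm; rewrite ?filter_uniq ?fset_uniq //.
    (* The map f is injective on P because P has no adjacent elements. *)
    rewrite map_inj_in_uniq ?fset_uniq // => p p' pP p'P.
    have nadj a b : a \in P -> b \in P -> a != b.-1.
      move=> aP bP; apply/eqP => ab; have : a \in fset0.
        by rewrite -P1 in_fsetI aP; apply/imfsetP; exists b.
      by rewrite in_fset0.
    have := Pn _ pP; have := Pn _ p'P; rewrite !in_zint /f.
    have := nadj _ _ pP p'P; have := nadj _ _ p'P pP.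
    by case: ifP; case: ifP; lia.
  move=> q; rewrite mem_filter; apply/idP/andP => [qP|[]//]; split=> //.
  by case/mapP: qP => p /fQ ? ->.
have fle p : p \in P -> (n - p <= n - f p)%N.
  by move=> _; apply: leq_sub2l; rewrite /f; case: ifP => // _; apply: leq_pred.
(* Strictness has two sources: either P misses some q in Q, where n - q > 0, or some p is really
   moved to p - 1. *)
have [/fsubsetP sPQ|/fsubsetPn[p pP pQ]] := boolP (P `<=` Q)%fset.
  have [q qQ qP] : exists2 q, q \in Q & q \notin P.
    apply/fsubsetPn; apply: contra neqPQ => QP.
    by rewrite eqEfsubset QP andbT; apply/fsubsetP.
  rewrite [X in (_ < X)%N](bigID (mem P)) /= -[X in (_ < X + _)%N]big_filter.
  rewrite (perm_big [seq q <- Q | q \in P]) /=; last first.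
    apply: uniq_perm; rewrite ?filter_uniq ?fset_uniq // => i.
    by rewrite mem_filter andb_idr //; apply: sPQ.
  rewrite -[X in (X < _)%N]addn0 ltn_add2l big_mkcond.
  rewrite (bigD1_seq q) ?fset_uniq //= qP.
  by have := Qn _ qQ; rewrite in_zint; lia.
apply: leq_trans ltn_sum; rewrite big_map.
rewrite (bigD1_seq p) ?fset_uniq //= [X in (_ < X)%N](bigD1_seq p) ?fset_uniq //=.
rewrite -addSn; apply: leq_add; last first.
  by rewrite big_seq_cond [X in (_ <= X)%N]big_seq_cond; apply: leq_sum => i /andP[/fle].
by rewrite /f (negbTE pQ); have := Pn _ pP; rewrite in_zint; lia.
Qed.

Hypothesis charK : [pchar K] =i pred0.

(** A nonzero coefficient needs some D inside [y.2] with [x.2] contained in the symmetric difference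
    of D and D + 1, hence in [y.2] and its shift. *)
Lemma Kst_desc_neq0 x y : peak_set x.1 x.2 -> peak_set y.1 y.2 ->
  Kst K x (mono (desccomp y)) != 0 ->
  x.1 = y.1 /\ (x.2 `<=` y.2 `|` shift1 y.2)%fset.
Proof.
move=> px py; have [ypos yn Dy] := desccompP (peak_set_sub py).
rewrite KstE exps_mono // yn Dy; case: (eqVneq y.1 x.1) => /= [->|_]; last first.
  by rewrite big1 ?mulr0 ?eqxx.
case: (boolP (x.2 `<=` _)%fset) => [//|nsub] ne0; exfalso; move/eqP: ne0; apply.
rewrite big1 ?mulr0 // => D Dx; case: (boolP (D `<=` y.2)%fset) => // /fsubsetP Dy2.
case/negP: nsub; apply/fsubsetP => i /(fsubsetP Dx).
rewrite !in_fsetU !in_fsetD !in_shift1 => /orP[/andP[_ /Dy2 ->] //|].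
by case/andP=> _ /andP[-> /Dy2 ->]; rewrite orbT.
Qed.

(** The coefficient is a positive integer, since D = P is among the sets counted; characteristic 0
    enters here. *)
Lemma Kst_desc x : peak_set x.1 x.2 -> Kst K x (mono (desccomp x)) != 0.
Proof.
move=> px; have [xpos xn Dx] := desccompP (peak_set_sub px).
have natK := (pcharf0P K).1 charK.
rewrite KstE exps_mono // xn Dx eqxx mulf_eq0 natK -natr_sum natK negb_or.
apply/andP; split; first by rewrite /stembridge_factor; case: ifP => // _; rewrite expn_eq0.
have xP : x.2 \in fpowerset (zint 1 x.1.-1) by rewrite fpowersetE peak_set_sub.
rewrite -big_filter (bigD1_seq x.2) ?filter_uniq ?fset_uniq ?mem_filter ?xP ?andbT //=.
  by rewrite fsubset_refl.
case/andP: px => _ /eqP P1; apply/fsubsetP => i iP.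
rewrite in_fsetU !in_fsetD iP andbT in_shift1; apply/orP; left.
apply/negP => /andP[i0 i1P]; have : i.-1 \in fset0.
  by rewrite -P1 in_fsetI i1P; apply/imfsetP; exists i.
by rewrite in_fset0.
Qed.

Lemma Kst_independent : independent peak_sets (Kst K).
Proof.
apply: (@triangular_independent _ _ _ _ _ (fun x => mono (desccomp x))
  (fun x => \sum_(p <- x.2) (x.1 - p))%N) => [x|x y px py].
  exact: Kst_desc.
move=> /(Kst_desc_neq0 py px)[]; case: x y px py => [n P] [m Q] /= px py mn sub.
subst m; rewrite xpair_eqE eqxx /= => neqPQ.
by apply: peak_rank; rewrite // eq_sym.
Qed.

End Bases.

(** * Theta is a homomorphism of algebras *)

Section Theta.
Variable K : fieldType.

Lemma linear_on_sub (V W : lmodType K) (S T : set V) (f : V -> W) :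
  S `<=` T -> linear_on T f -> linear_on S f.
Proof. by move=> ST linf a v w /ST Tv /ST Tw; apply: linf. Qed.

Lemma linear_on_comp (V W U : lmodType K) (S : set V) (T : set W)
    (f : V -> W) (g : W -> U) :
  (forall v, S v -> T (f v)) -> linear_on S f -> linear_on T g ->
  linear_on S (fun v => g (f v)).
Proof.
by move=> ST linf ling a v w Sv Sw; rewrite linf // ling //; apply: ST.
Qed.

Lemma linear_on_eval (X : Type) (S : set (X -> K^o)) x :
  linear_on S (fun f : X -> K^o => f x : K^o).
Proof. by []. Qed.

Lemma linear_on_scale (V : lmodType K) (S : set V) (f : V -> K^o) (b : K) :
  linear_on S f -> linear_on S (fun v => f v * b : K^o).
Proof. by move=> linf a v w Sv Sw; rewrite linf // mulrDl -mulrA. Qed.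

Lemma linear_on_scalel (V : lmodType K) (S : set V) (f : V -> K^o) (b : K) :
  linear_on S f -> linear_on S (fun v => b * f v : K^o).
Proof. by move=> linf a v w Sv Sw; rewrite linf // mulrDr mulrCA. Qed.

Lemma Qsym_subspace : subspace (Qsym K).
Proof. exact: span_subspace. Qed.

Lemma Mon_Qsym r : all (leq 1) r -> Qsym K (Mon K r).
Proof. exact: (@span_basis _ _ _ compositions). Qed.

Lemma Fundw_Qsym q : all (leq 1) q -> Qsym K (Fundw K q).
Proof. by move=> qpos; rewrite QsymE; exact: (@span_basis _ _ _ compositions). Qed.

Lemma Qsym_exps f : Qsym K f -> f = (fun t => f (mono t)) \o exps.
Proof.
move=> Qf; apply: funext => m; move: f Qf.
apply: span_ext; [exact: linear_on_eval|exact: linear_on_eval|].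
by move=> r rpos; rewrite /= !MonE // exps_mono ?exps_pos.
Qed.

Lemma Mon_mul r s : all (leq 1) r -> all (leq 1) s ->
  series_mul (Mon K r) (Mon K s) = \sum_(u <- qshuffle r s) Mon K u.
Proof.
move=> rpos spos; apply: funext => m; rewrite fct_sumE.
have ME q : all (leq 1) q -> Mon K q = (fun t => (t == q)%:R : K^o) \o exps.
  by move=> qpos; apply: funext => m'; rewrite /= MonE.
rewrite (ME r) // (ME s) // series_mulE -qshuffle_splits ?exps_pos //.
by apply: eq_big_seq => u /(all_qshuffle rpos spos) upos; rewrite MonE.
Qed.

Lemma Qsym_mul f g : Qsym K f -> Qsym K g -> Qsym K (series_mul f g).
Proof.
have pre (h : series K -> series K) : linear_on setT h ->
    (forall r, all (leq 1) r -> Qsym K (h (Mon K r))) ->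
    forall f, Qsym K f -> Qsym K (h f).
  move=> linh hM; apply: (@span_min _ _ _ _ _ (fun f => Qsym K (h f))) => //.
  split; first by rewrite (@linear_on0 _ _ _ setT) //; apply: (Qsym_subspace).1.
  by move=> a v w hv hw; rewrite linh //; apply: (Qsym_subspace).2.
move=> Qf Qg; move: f Qf; apply: (pre); first exact: series_mul_linearl.
move=> r rpos; move: g Qg; apply: (pre); first exact: series_mul_linearr.
move=> s spos; rewrite Mon_mul //; apply: (subspace_sum Qsym_subspace).
by move=> u /(all_qshuffle rpos spos) upos _; apply: Mon_Qsym.
Qed.

Definition Tmon (r : seq nat) : series K := thetaM K r \o exps.

Lemma Kst_thetaM q : all (leq 1) q ->
  Kst K (sumn q, peak_part (sumn q) (Dset q)) =
  \sum_(r <- comps (sumn q) | (Dset q `<=` Dset r)%fset) Tmon r.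
Proof.
move=> qpos; apply: funext => m; rewrite KstE fct_sumE /Tmon /=.
have mpos := exps_pos m.
(* Degree 0 is separate: the Stembridge factor is 1 there, and bit sequences encode compositions of
   positive integers only. *)
case: (eqVneq q [::]) => [->|q0].
  rewrite (perm_big _ (perm_fpowerset 0)) /= !big_cons !big_nil.
  have -> : bitset [::] = fset0 by apply/fsetP => i; rewrite in_bitset in_fset0 nth_nil andbF.
  have -> : peak_part 0 (Dset [::]) = fset0.
    by apply/fsetP => i; rewrite in_fsetI Dset_nil in_fset0.
  rewrite fsub0set fsubset_refl !addr0 mul1r fsub0set andbT.
  case: (exps m) mpos => [|[//|k] t] //= _.
  by rewrite thetaM_cons big_seq1 /= !mul0r.
have [d dq] := bitcomp_surj qpos q0; rewrite -dq sumn_bitcomp Dset_bitcomp.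
case: (eqVneq (sumn (exps m)) (size d).+1) => [sm|sm]; last first.
  rewrite big1 ?mulr0; last by move=> D _.
  rewrite big1_seq // => r /andP[_]; rewrite mem_comps => /andP[_ /eqP sr].
  by rewrite thetaM_sumn // sr eq_sym.
have [t tm] : exists t, bitcomp t = exps m.
  by apply: bitcomp_surj => //; apply: contra_eq_neq sm => ->.
have sdt : size d = size t by apply: succn_inj; rewrite -sm -tm sumn_bitcomp.
rewrite -tm Dset_bitcomp; exact: thetaM_fundamental.
Qed.

Lemma theta_linear : linear_on (Qsym K) (theta (K := K)).
Proof. rewrite QsymE; apply: linext_linear; exact: Fundw_independent. Qed.

Lemma theta_Fundw q : all (leq 1) q ->
  theta (Fundw K q) = Kst K (sumn q, peak_part (sumn q) (Dset q)).
Proof. by move=> qpos; rewrite /theta linext_basis //; apply: Fundw_independent. Qed.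

(** The linear extension of [Tmon] from the basis M agrees with theta on every F_D by [Kst_thetaM],
    hence on all of Qsym; the expansion of M in terms of F is never written down. *)
Lemma theta_Mon r : all (leq 1) r -> theta (Mon K r) = Tmon r.
Proof.
move=> rpos; have indM := @Mon_independent K.
rewrite -[RHS](linext_basis indM Tmon rpos).
have := Mon_Qsym rpos; rewrite QsymE; move: (Mon K r).
apply: span_ext; rewrite -?QsymE; [exact: theta_linear|exact: linext_linear|].
move=> q qpos; rewrite theta_Fundw // Kst_thetaM //.
rewrite /Fundw FundM (linear_on_sum Qsym_subspace (linext_linear indM Tmon)).
  rewrite big_seq_cond [RHS]big_seq_cond; apply: eq_bigr => s /andP[].
  by rewrite mem_comps => /andP[spos _] _; rewrite linext_basis.
by move=> s; rewrite mem_comps => /andP[spos _] _; apply: Mon_Qsym.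
Qed.

Lemma theta_mul f g : Qsym K f -> Qsym K g ->
  theta (series_mul f g) = series_mul (theta f) (theta g).
Proof.
move=> Qf Qg; move: f Qf; apply: span_ext.
- exact: (linear_on_comp (fun f Qf => Qsym_mul Qf Qg)
    (linear_on_sub (@subsetT _ _) (series_mul_linearl g)) theta_linear).
- exact: (linear_on_comp (fun f Qf => I) theta_linear (series_mul_linearl _)).
move=> r rpos; have Qr := Mon_Qsym rpos; move: g Qg; apply: span_ext.
- exact: (linear_on_comp (fun g Qg => Qsym_mul Qr Qg)
    (linear_on_sub (@subsetT _ _) (series_mul_linearr _)) theta_linear).
- exact: (linear_on_comp (fun f Qf => I) theta_linear (series_mul_linearr _)).
move=> s spos; rewrite Mon_mul // !theta_Mon //.
rewrite (linear_on_sum Qsym_subspace theta_linear); last first.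
  by move=> u /(all_qshuffle rpos spos) upos _; apply: Mon_Qsym.
apply: funext => m; rewrite fct_sumE series_mulE.
transitivity (\sum_(u <- qshuffle r s) thetaM K u (exps m)).
  by apply: eq_big_seq => u /(all_qshuffle rpos spos) upos; rewrite theta_Mon.
(* On the right [series_mulE] has filtered the zeros out of the splittings; since r and s are
   positive, [thetaM] does not notice. *)
rewrite thetaM_qshuffle; apply: eq_bigr => p _.
by rewrite (thetaM_pos _ _ rpos) (thetaM_pos _ _ spos).
Qed.

Lemma theta_stembridge f : Qsym K f -> stembridge_algebra K (theta f).
Proof.
rewrite QsymE => Qf; apply: linext_in => //; first exact: Fundw_independent.
  exact: span_subspace.
move=> q qpos; apply: span_basis.
by apply: peak_part_peak_set; apply: Dset_sub.
Qed.

(** Read as a descent set, P is its own peak part. The Stembridge algebra is thus the image of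
    theta, which gives its closure under products. *)
Lemma Kst_theta x : peak_set x.1 x.2 ->
  Kst K x = theta (Fundw K (desccomp x)) /\ Qsym K (Fundw K (desccomp x)).
Proof.
move=> px; have [qpos qn Dq] := desccompP (peak_set_sub px).
rewrite theta_Fundw // qn Dq peak_part_id //; split; last exact: Fundw_Qsym.
by case: x {px qpos qn Dq}.
Qed.

Lemma stembridge_mul f g : stembridge_algebra K f -> stembridge_algebra K g ->
  stembridge_algebra K (series_mul f g).
Proof.
have pre (h : series K -> series K) : linear_on setT h ->
    (forall x, peak_set x.1 x.2 -> stembridge_algebra K (h (Kst K x))) ->
    forall f, stembridge_algebra K f -> stembridge_algebra K (h f).
  move=> linh hM; apply: (@span_min _ _ _ _ _ (fun f => stembridge_algebra K (h f))) => //.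
  have subS : subspace (stembridge_algebra K) by exact: span_subspace.
  split; first by rewrite (@linear_on0 _ _ _ setT) //; apply: subS.1.
  by move=> a v w hv hw; rewrite linh //; apply: subS.2.
move=> Sf Sg; move: f Sf; apply: (pre); first exact: series_mul_linearl.
move=> x px; move: g Sg; apply: (pre); first exact: series_mul_linearr.
move=> y py; have [-> Qx] := Kst_theta px; have [-> Qy] := Kst_theta py.
by rewrite -theta_mul //; apply: theta_stembridge; apply: Qsym_mul.
Qed.

End Theta.

Local Notation dpair := Defs.dpair.

(** * The coproduct and the pairings *)

Section Duality.
Variable K : fieldType.
Hypothesis charK : [pchar K] =i pred0.

Let indP := @Pi_independent K.
Let indK := Kst_independent charK.
Let indX := @Xiw_independent K.
Let indXX := tens_independent indX indX.

Lemma delta_pairing_coordr (I : choiceType) (V V' : lmodType K) (A : set I)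
    (b : I -> V) (b' : I -> V') : independent A b -> independent A b' ->
  forall i v, A i -> span A b' v ->
  bilext A b A b' (fun i j => (i == j)%:R : K^o) (b i) v = coord A b' v i.
Proof.
move=> indb indb' i v Ai; move: v; apply: span_ext.
- apply: bilext_linearr => //; exact: span_basis.
- by move=> a v w Sv Sw; rewrite coordD.
by move=> j Aj; rewrite bilext_basis // coord_basis.
Qed.

Lemma delta_pairing_coordl (I : choiceType) (V V' : lmodType K) (A : set I)
    (b : I -> V) (b' : I -> V') : independent A b -> independent A b' ->
  forall i v, A i -> span A b v ->
  bilext A b A b' (fun i j => (i == j)%:R : K^o) v (b' i) = coord A b v i.
Proof.
move=> indb indb' i v Ai; move: v; apply: span_ext.
- exact: bilext_linearl.
- by move=> a v w Sv Sw; rewrite coordD.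
by move=> j Aj; rewrite bilext_basis // coord_basis // eq_sym.
Qed.

Lemma coord_eq0 (I : choiceType) (V : lmodType K) (A : set I) (b : I -> V) v :
  independent A b -> span A b v -> (forall i, A i -> coord A b v i = 0) -> v = 0.
Proof.
move=> indb Sv c0; have /combinesP[s [_ sA _ ->]] := coord_combines indb Sv.
by apply: big1_seq => i /= /sA/c0 ->; rewrite scale0r.
Qed.

Lemma ppair_linearl (f : series K) :
  linear_on (peak_algebra K) ((@ppair K)^~ f : _ -> K^o).
Proof. exact: bilext_linearl. Qed.

Lemma ppair_linearr phi : peak_algebra K phi ->
  linear_on (stembridge_algebra K) (@ppair K phi : _ -> K^o).
Proof. exact: bilext_linearr. Qed.

Lemma ppair_basis x y : peak_set x.1 x.2 -> peak_set y.1 y.2 ->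
  ppair (Pi K x) (Kst K y) = (x == y)%:R.
Proof. by move=> px py; rewrite /ppair bilext_basis. Qed.

Lemma ppair_nondegl phi : peak_algebra K phi ->
  (forall f, stembridge_algebra K f -> ppair phi f = 0) -> phi = 0.
Proof.
move=> Pphi phi0; apply: (coord_eq0 indP Pphi) => x px.
rewrite -(delta_pairing_coordl indP indK) //.
by apply: phi0; apply: (@span_basis _ _ _ peak_sets).
Qed.

Lemma ppair_nondegr f : stembridge_algebra K f ->
  (forall phi, peak_algebra K phi -> ppair phi f = 0) -> f = 0.
Proof.
move=> Sf f0; apply: (coord_eq0 indK Sf) => x px.
rewrite -(delta_pairing_coordr indP indK) //.
by apply: f0; apply: (@span_basis _ _ _ peak_sets).
Qed.

Lemma peak_descent : peak_algebra K `<=` descent_algebra K.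
Proof.
apply: span_min; first exact: span_subspace.
move=> x px; rewrite Pi_descent; apply: (subspace_sum (span_subspace _ _)).
move=> r; rewrite mem_comps => /andP[rpos _] _.
exact: (@span_basis _ _ _ compositions).
Qed.

Lemma dpair_linearl f : linear_on (descent_algebra K) ((@dpair K)^~ f : _ -> K^o).
Proof. by apply: bilext_linearl; apply: Deltaw_independent. Qed.

Lemma dpair_linearr phi : descent_algebra K phi ->
  linear_on (Qsym K) (@dpair K phi : _ -> K^o).
Proof.
rewrite QsymE; apply: bilext_linearr; first exact: Deltaw_independent.
exact: Fundw_independent.
Qed.

Lemma dpair_Fundw phi q : descent_algebra K phi -> all (leq 1) q ->
  dpair phi (Fundw K q) = phi (wordperm q).
Proof.
move=> Dphi qpos; move: phi Dphi.
apply: (@span_ext _ _ _ _ _ _ (fun phi => dpair phi (Fundw K q) : K^o)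
  (fun phi => phi (wordperm q))).
- exact: dpair_linearl.
- exact: linear_on_eval.
move=> r rpos; rewrite Deltaw_word // /dpair bilext_basis //.
- by rewrite eq_sym.
- exact: Deltaw_independent.
exact: Fundw_independent.
Qed.

(** The bases Xi and M are dual to each other, as one sees by pairing with the F_q. *)
Lemma dpair_Xiw t f : all (leq 1) t -> Qsym K f -> dpair (Xiw K t) f = f (mono t).
Proof.
move=> tpos; have DX : descent_algebra K (Xiw K t).
  by rewrite descent_algebraE; exact: (@span_basis _ _ _ compositions).
rewrite QsymE; move: f; apply: (@span_ext _ _ _ _ _ _ (@dpair K (Xiw K t) : _ -> K^o)
  (fun f => f (mono t))).
- by rewrite -QsymE; apply: dpair_linearr.
- exact: linear_on_eval.
move=> q qpos; rewrite dpair_Fundw // Xiw_word // Fundw_word // [in RHS]eq_sym.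
by rewrite eq_sym.
Qed.

Lemma dpair_theta phi f : peak_algebra K phi -> Qsym K f ->
  dpair phi f = ppair phi (theta f).
Proof.
move=> Pphi Qf; move: phi Pphi; apply: (@span_ext _ _ _ _ _ _
  (fun phi => dpair phi f : K^o) (fun phi => ppair phi (theta f) : K^o)).
- exact: linear_on_sub peak_descent (dpair_linearl f).
- exact: ppair_linearl.
move=> x px; have Px : peak_algebra K (Pi K x) by exact: (@span_basis _ _ _ peak_sets).
move: f Qf; rewrite QsymE; apply: (@span_ext _ _ _ _ _ _
  (@dpair K (Pi K x) : _ -> K^o) (fun f => ppair (Pi K x) (theta f) : K^o)).
- by rewrite -QsymE; apply: dpair_linearr; apply: peak_descent.
- rewrite -QsymE; exact: (linear_on_comp (@theta_stembridge K) (@theta_linear K)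
    (ppair_linearr Px)).
move=> q qpos; rewrite dpair_Fundw //; last exact: peak_descent.
rewrite theta_Fundw // ppair_basis //; last first.
  by apply: peak_part_peak_set; apply: Dset_sub.
rewrite PiE PeakE; have [tE dE] := wordpermP qpos.
by rewrite dE tE -xpair_eqE eq_sym; case: (x).
Qed.

Lemma peak_perp_ker_theta : peak_perp K = ker_theta K.
Proof.
apply/seteqP; split=> f [Qf f0]; split=> //.
  apply: ppair_nondegr; first exact: theta_stembridge.
  by move=> phi Pphi; rewrite -dpair_theta // f0.
move=> phi Pphi; rewrite dpair_theta // f0.
exact: (linear_on0 (span_subspace _ _) (ppair_linearr Pphi)).
Qed.

Lemma star_Xiw r q : all (leq 1) r -> all (leq 1) q ->
  star (Xiw K r) (Xiw K q) = Xiw K (r ++ q).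
Proof. by move=> rpos qpos; rewrite /star bilext_basis. Qed.

Lemma all_nz t : all (leq 1) (nz t).
Proof. exact: filter_all. Qed.

Definition XX (p : seq nat * seq nat) : perms * perms -> K^o :=
  tens (Xiw K p.1) (Xiw K p.2).

Lemma star2_XX a b c d : all (leq 1) a -> all (leq 1) b ->
  all (leq 1) c -> all (leq 1) d ->
  star2 (XX (a, b)) (XX (c, d)) = XX (a ++ c, b ++ d).
Proof.
move=> apos bpos cpos dpos; rewrite /star2 /XX.
rewrite (@bilext_basis _ _ _ _ _ _ _ (fun x => tens (Xiw K x.1) (Xiw K x.2))
  _ (fun x => tens (Xiw K x.1) (Xiw K x.2)) _ _ _ (a, b) (c, d)) //=.
by rewrite !star_Xiw.
Qed.

Let S2 := span (compositions `*` compositions) XX.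

Lemma star2_linearl u : linear_on S2 ((@star2 K)^~ u).
Proof. exact: (bilext_linearl _ _ _ indXX). Qed.

Lemma star2_linearr v : S2 v -> linear_on S2 (@star2 K v).
Proof. exact: (bilext_linearr _ indXX indXX). Qed.

(** Expanding the product of the coproducts of the Xi^k means choosing a splitting of every letter
    of t. *)
Lemma coprod_XiwE t : coprod_Xiw K t =
  \sum_(p <- splits t) XX (nz p.1, nz p.2).
Proof.
elim: t => [|k t IHt]; first by rewrite big_seq1.
have XiwE1 j : Xiw K [:: j] = Xiw K (nz [:: j]).
  case: j => [|j] //; rewrite /Xiw; congr Xi; apply/fsetP => x.
  by apply/mem_Dset/mem_Dset => -[[|i] //].
rewrite /= IHt big_splits_cons.
rewrite -(big_mkord xpredT (fun j => tens (Xiw K [:: j]) (Xiw K [:: (k - j)%N]))).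
have subXX : subspace S2 := span_subspace (compositions `*` compositions) XX.
have SXX a b : S2 (XX (nz a, nz b)).
  by apply: span_basis; split; apply: all_nz.
rewrite /index_iota subn0.
rewrite (linear_on_sum subXX (star2_linearl _)); last first.
  by move=> j _ _; rewrite !XiwE1; apply: SXX.
apply: eq_bigr => j _.
rewrite (linear_on_sum subXX (star2_linearr _)); first last.
- by move=> p _ _; apply: SXX.
- by rewrite !XiwE1; apply: SXX.
apply: eq_bigr => p _; rewrite !XiwE1.
by rewrite -/(XX (nz [:: j], nz [:: (k - j)%N])) star2_XX ?all_nz // -!filter_cat.
Qed.

Definition permFund (s : perms) : series K := Fund K (tag s) (Des (tagged s)).

Definition permpeak (s : perms) : nat * {fset nat} := (tag s, Peak (tagged s)).

Lemma permFund_Qsym s : Qsym K (permFund s).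
Proof.
have [q [qpos qn qD]] := Dset_surj (Des_sub (tagged s)).
by rewrite /permFund -qD -qn; apply: Fundw_Qsym.
Qed.

Lemma theta_permFund s : theta (permFund s) = Kst K (permpeak s).
Proof.
have [q [qpos qn qD]] := Dset_surj (Des_sub (tagged s)).
by rewrite /permFund /permpeak PeakE -qD -qn; apply: theta_Fundw.
Qed.

Lemma permpeak_peak_set s : peak_set (permpeak s).1 (permpeak s).2.
Proof. by rewrite /= PeakE; apply: peak_part_peak_set; apply: Des_sub. Qed.

Lemma coprod_linear : linear_on (descent_algebra K) (@coprod K).
Proof. by rewrite descent_algebraE; apply: linext_linear. Qed.

Lemma coprod_Xi t : all (leq 1) t -> coprod (Xiw K t) = coprod_Xiw K t.
Proof. by move=> tpos; rewrite /coprod linext_basis. Qed.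

(** The value at (s, t) is the coefficient of the tensor of the corresponding Deltas. For phi = Xi^q
    both sides become the same sum over [splits q]. *)
Lemma coprodE phi s t : descent_algebra K phi ->
  coprod phi (s, t) = dpair phi (series_mul (permFund s) (permFund t)).
Proof.
have linD := coprod_linear; have lind := dpair_linearl.
rewrite descent_algebraE in linD lind *; move: phi.
apply: (@span_ext _ _ _ _ _ _ (fun phi => coprod phi (s, t) : K^o)
  (fun phi => dpair phi (series_mul (permFund s) (permFund t)) : K^o)).
- exact: (linear_on_comp (fun _ _ => I) linD (@linear_on_eval _ _ setT (s, t))).
- exact: lind.
move=> q qpos; rewrite coprod_Xi // coprod_XiwE dpair_Xiw //; last first.
  by apply: Qsym_mul; apply: permFund_Qsym.
rewrite fct_sumE (Qsym_exps (permFund_Qsym s)) (Qsym_exps (permFund_Qsym t)).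
rewrite series_mulE exps_mono //; apply: eq_bigr => p _.
rewrite /XX /tens /= /Xiw !XiE /permFund !FundE !exps_mono ?all_nz //.
by congr (_ * _); rewrite eq_sym.
Qed.

Lemma coprod_peakE phi s t : peak_algebra K phi -> coprod phi (s, t) =
  ppair phi (series_mul (Kst K (permpeak s)) (Kst K (permpeak t))).
Proof.
move=> Pphi; rewrite coprodE; last exact: peak_descent.
have Qs := permFund_Qsym s; have Qt := permFund_Qsym t.
by rewrite dpair_theta ?theta_mul ?theta_permFund //; apply: Qsym_mul.
Qed.

End Duality.

(** * The peak coalgebra and the pairing of the tensor squares *)

Section PeakCoalgebra.
Variable K : fieldType.
Hypothesis charK : [pchar K] =i pred0.

Let indP := @Pi_independent K.
Let indK := Kst_independent charK.
Let indPP := tens_independent indP indP.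
Let indKK := tens_independent indK indK.

(** Vectors are arbitrary functions on pairs of permutations; a bound on the degrees is what makes
    the expansion of a coproduct a finite sum. *)
Lemma coprod_bounded phi : descent_algebra K phi -> exists N, forall s t,
  ~~ ((tag s <= N) && (tag t <= N))%N -> coprod phi (s, t) = 0.
Proof.
have linD := @coprod_linear K; have subD : subspace (descent_algebra K).
  exact: span_subspace.
rewrite descent_algebraE in linD subD * => Dphi.
(* Membership is carried along because [coprod] is linear on the descent algebra only. *)
suff [] : span compositions (Xiw K) phi /\ exists N, forall s t,
  ~~ ((tag s <= N) && (tag t <= N))%N -> coprod phi (s, t) = 0 by [].
move: phi Dphi; apply: span_min => [|q qpos].
  split; first by split; [exact: subD.1 | exists 0%N => s t _; rewrite (linear_on0 subD linD)].
  move=> a f g [Df [M fM]] [Dg [N gN]]; split; first exact: subD.2.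
  exists (maxn M N) => s t; rewrite !leq_max => stMN; rewrite linD //.
  change (a * coprod f (s, t) + coprod g (s, t) = 0).
  rewrite fM ?gN ?mulr0 ?addr0 //; apply: contra stMN => /andP[-> ->] //.
  by rewrite !orbT.
split; first exact: (@span_basis _ _ _ compositions).
exists (\max_(p <- splits q) (sumn (nz p.1) + sumn (nz p.2)))%N => s t stN.
rewrite coprod_Xi // coprod_XiwE fct_sumE big1_seq // => p /= pq.
rewrite /XX /tens /= /Xiw !XiE -natrM mulnb; case: andP => // -[/andP[/eqP sp _] /andP[/eqP tp _]].
case/negP: stN; rewrite sp tp.
have := @leq_bigmax_seq _ (splits q) xpredT (fun p => (sumn (nz p.1) + sumn (nz p.2))%N) p pq isT.
by move=> le; apply/andP; split; apply: leq_trans le; rewrite ?leq_addr ?leq_addl.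
Qed.

Definition peak_seq (N : nat) : seq (nat * {fset nat}) :=
  [seq (n, P) | n <- iota 0 N.+1, P <- [seq P <- fpowerset (zint 1 n.-1) | peak_set n P]].

Lemma mem_peak_seq N x : (x \in peak_seq N) = (x.1 <= N)%N && peak_set x.1 x.2.
Proof.
apply/allpairsPdep/andP => [[n [P [+ + ->]]]|[xN px]].
  by rewrite mem_iota mem_filter => nN /andP[].
exists x.1, x.2; split; last by case: x {xN px}.
  by rewrite mem_iota.
by rewrite mem_filter px fpowersetE peak_set_sub.
Qed.

Lemma peak_seq_uniq N : uniq (peak_seq N).
Proof.
apply: allpairs_uniq_dep; first exact: iota_uniq.
  by move=> n _; rewrite filter_uniq ?fset_uniq.
by move=> [n P] [m Q] _ _ /= [-> ->].
Qed.

Lemma sum_delta (J : eqType) (s : seq J) (F : J -> K) j0 : uniq s ->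
  \sum_(j <- s) F j * (j0 == j)%:R = if j0 \in s then F j0 else 0.
Proof.
move=> us; case: ifP => js; last first.
  by rewrite big1_seq // => j /= sj; case: eqP => [e|]; [rewrite -e js in sj|rewrite mulr0].
rewrite (bigD1_seq j0) //= eqxx mulr1 big1 ?addr0 // => j.
by rewrite eq_sym => /negbTE ->; rewrite mulr0.
Qed.

Lemma Pi_permpeak x s : Pi K x s = (permpeak s == x)%:R.
Proof. by rewrite PiE; case: x. Qed.

Lemma coprod_peak_expansion phi : peak_algebra K phi -> exists N, coprod phi =
  \sum_(x <- peak_seq N) \sum_(y <- peak_seq N)
    ppair phi (series_mul (Kst K x) (Kst K y)) *: tens (Pi K x) (Pi K y).
Proof.
move=> Pphi; have [N bN] := coprod_bounded (peak_descent Pphi).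
exists N; apply: funext => -[s t]; rewrite fct_sumE.
pose c x y := ppair phi (series_mul (Kst K x) (Kst K y)).
transitivity (\sum_(x <- peak_seq N)
  (\sum_(y <- peak_seq N) c x y * (permpeak t == y)%:R) * (permpeak s == x)%:R).
  under eq_bigr do rewrite sum_delta ?peak_seq_uniq //.
  (* Only the pair of peak indices of s and t contributes, and it is listed exactly when both
     degrees are at most N. *)
  rewrite sum_delta ?peak_seq_uniq // !mem_peak_seq !permpeak_peak_set !andbT /=.
  case: (boolP (tag s <= N)%N) => sN; last by rewrite bN ?(negbTE sN).
  case: (boolP (tag t <= N)%N) => tN; last by rewrite bN ?sN.
  by rewrite (coprod_peakE charK).
apply: eq_bigr => x _; rewrite fct_sumE mulr_suml; apply: eq_bigr => y _.
change (c x y * (permpeak t == y)%:R * (permpeak s == x)%:R =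
  c x y * (Pi K x s * Pi K y t)).
by rewrite !Pi_permpeak -mulrA [_%:R * _]mulrC.
Qed.

Lemma coprod_peak phi : peak_algebra K phi -> peak_algebra2 K (coprod phi).
Proof.
move=> /coprod_peak_expansion[N ->].
have subPP : subspace (peak_algebra2 K) by exact: span_subspace.
apply: (subspace_sum subPP) => x; rewrite mem_peak_seq => /andP[_ px] _.
apply: (subspace_sum subPP) => y; rewrite mem_peak_seq => /andP[_ py] _.
apply: (subspaceZ subPP).
exact: (@span_basis _ _ _ (peak_sets `*` peak_sets)
  (fun x => tens (Pi K x.1) (Pi K x.2)) (x, y)).
Qed.

Definition stembridge2 : set ({cmonom nat} * {cmonom nat} -> K^o) :=
  span (peak_sets `*` peak_sets) (fun x => tens (Kst K x.1) (Kst K x.2)).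

Lemma ppair2_linearl u :
  linear_on (peak_algebra2 K) ((@ppair2 K)^~ u : _ -> K^o).
Proof. exact: (bilext_linearl _ _ _ indPP). Qed.

Lemma ppair2_linearr t : peak_algebra2 K t ->
  linear_on stembridge2 (@ppair2 K t : _ -> K^o).
Proof. exact: (bilext_linearr _ indPP indKK). Qed.

Lemma ppair2_basis x y z w : peak_set x.1 x.2 -> peak_set y.1 y.2 ->
  peak_set z.1 z.2 -> peak_set w.1 w.2 ->
  ppair2 (tens (Pi K x) (Pi K y)) (tens (Kst K z) (Kst K w)) =
  (x == z)%:R * (y == w)%:R.
Proof.
move=> px py pz pw; rewrite /ppair2.
rewrite (@bilext_basis _ _ _ _ _ _ _ (fun x => tens (Pi K x.1) (Pi K x.2))
  _ (fun x => tens (Kst K x.1) (Kst K x.2)) _ indPP indKK (x, y) (z, w)) //=.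
by rewrite !(ppair_basis charK).
Qed.

Lemma span_tens (X Y : Type) (I J : choiceType) (A : set I) (B : set J)
    (b : I -> X -> K^o) (b' : J -> Y -> K^o) f g :
  span A b f -> span B b' g ->
  span (A `*` B) (fun x => tens (b x.1) (b' x.2)) (tens f g).
Proof.
set T := span _ (fun x : I * J => _); have subT : subspace T by exact: span_subspace.
move=> Sf Sg; move: f Sf; apply: (@span_min _ _ _ _ _ (fun f => T (tens f g))).
  split; first by rewrite (linear_on0 (S := setT) _ (tens_linearl g)) //; apply: subT.1.
  by move=> a v w Tv Tw; rewrite tens_linearl //; apply: subT.2.
move=> i Ai; move: g Sg; apply: (@span_min _ _ _ _ _ (fun g => T (tens (b i) g))).
  split; first by rewrite (linear_on0 (S := setT) _ (tens_linearr (b i))) //; apply: subT.1.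
  by move=> a v w Tv Tw; rewrite tens_linearr //; apply: subT.2.
by move=> j Bj; apply: (@span_basis _ _ _ (A `*` B)
  (fun x => tens (b x.1) (b' x.2)) (i, j)).
Qed.

Lemma ppair2_tens phi psi f g :
  peak_algebra K phi -> peak_algebra K psi ->
  stembridge_algebra K f -> stembridge_algebra K g ->
  ppair2 (tens phi psi) (tens f g) = ppair phi f * ppair psi g.
Proof.
move=> Pphi Ppsi Sf Sg; move: phi Pphi; apply: (@span_ext _ _ _ _ _ _
  (fun phi => ppair2 (tens phi psi) (tens f g) : K^o)
  (fun phi => ppair phi f * ppair psi g : K^o)).
- exact: (linear_on_comp (fun phi Pphi => span_tens Pphi Ppsi)
    (linear_on_sub (@subsetT _ _) (tens_linearl psi)) (ppair2_linearl (tens f g))).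
- exact: (linear_on_scale _ (ppair_linearl f)).
move=> x px; have Px : peak_algebra K (Pi K x) by exact: (@span_basis _ _ _ peak_sets).
move: psi Ppsi; apply: (@span_ext _ _ _ _ _ _
  (fun psi => ppair2 (tens (Pi K x) psi) (tens f g) : K^o)
  (fun psi => ppair (Pi K x) f * ppair psi g : K^o)).
- exact: (linear_on_comp (fun psi Ppsi => span_tens Px Ppsi)
    (linear_on_sub (@subsetT _ _) (tens_linearr _)) (ppair2_linearl (tens f g))).
- exact: (linear_on_scalel _ (ppair_linearl g)).
move=> y py; have Py : peak_algebra K (Pi K y) by exact: (@span_basis _ _ _ peak_sets).
move: f Sf; apply: (@span_ext _ _ _ _ _ _
  (fun f => ppair2 (tens (Pi K x) (Pi K y)) (tens f g) : K^o)
  (fun f => ppair (Pi K x) f * ppair (Pi K y) g : K^o)).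
- exact: (linear_on_comp (fun f Sf => span_tens Sf Sg)
    (linear_on_sub (@subsetT _ _) (tens_linearl g))
    (ppair2_linearr (span_tens Px Py))).
- exact: (linear_on_scale _ (ppair_linearr charK Px)).
move=> z pz; have Sz : stembridge_algebra K (Kst K z) by exact: (@span_basis _ _ _ peak_sets).
move: g Sg; apply: (@span_ext _ _ _ _ _ _
  (fun g => ppair2 (tens (Pi K x) (Pi K y)) (tens (Kst K z) g) : K^o)
  (fun g => ppair (Pi K x) (Kst K z) * ppair (Pi K y) g : K^o)).
- exact: (linear_on_comp (fun g Sg => span_tens Sz Sg)
    (linear_on_sub (@subsetT _ _) (tens_linearr _))
    (ppair2_linearr (span_tens Px Py))).
- exact: (linear_on_scalel _ (ppair_linearr charK Py)).
by move=> w pw; rewrite ppair2_basis // !(ppair_basis charK).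
Qed.

Lemma ppair_mul phi f g : peak_algebra K phi ->
  stembridge_algebra K f -> stembridge_algebra K g ->
  ppair phi (series_mul f g) = ppair2 (coprod phi) (tens f g).
Proof.
move=> Pphi Sf Sg; have PPphi := coprod_peak Pphi.
move: f Sf; apply: (@span_ext _ _ _ _ _ _
  (fun f => ppair phi (series_mul f g) : K^o)
  (fun f => ppair2 (coprod phi) (tens f g) : K^o)).
- exact: (linear_on_comp (fun f Sf => stembridge_mul Sf Sg)
    (linear_on_sub (@subsetT _ _) (series_mul_linearl g)) (ppair_linearr charK Pphi)).
- exact: (linear_on_comp (fun f Sf => span_tens Sf Sg)
    (linear_on_sub (@subsetT _ _) (tens_linearl g)) (ppair2_linearr PPphi)).
move=> x px; have Sx : stembridge_algebra K (Kst K x) by exact: (@span_basis _ _ _ peak_sets).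
move: g Sg; apply: (@span_ext _ _ _ _ _ _
  (fun g => ppair phi (series_mul (Kst K x) g) : K^o)
  (fun g => ppair2 (coprod phi) (tens (Kst K x) g) : K^o)).
- exact: (linear_on_comp (fun g Sg => stembridge_mul Sx Sg)
    (linear_on_sub (@subsetT _ _) (series_mul_linearr _)) (ppair_linearr charK Pphi)).
- exact: (linear_on_comp (fun g Sg => span_tens Sx Sg)
    (linear_on_sub (@subsetT _ _) (tens_linearr _)) (ppair2_linearr PPphi)).
move=> y py.
have descpeak z : peak_set z.1 z.2 -> permpeak (descperm z) = z.
  move=> pz; have [tE dE] := descpermP (peak_set_sub pz).
  by rewrite /permpeak PeakE dE tE peak_part_id //; case: z {pz tE dE}.
(* With permutations of peak sets x and y, the left side is a value of the coproduct. Both sides are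
   then linear in the coproduct, which lies in the tensor square of the peak algebra, and can be
   compared on its basis. *)
rewrite -[in LHS](descpeak x px) -[in LHS](descpeak y py) -(coprod_peakE charK) //.
move: (coprod phi) PPphi; apply: (@span_ext _ _ _ _ _ _
  (fun t => t (descperm x, descperm y))
  (fun t => ppair2 t (tens (Kst K x) (Kst K y)) : K^o)).
- exact: linear_on_eval.
- exact: ppair2_linearl.
move=> [z w] [pz pw] /=; rewrite ppair2_basis //.
by rewrite /tens /= !Pi_permpeak !descpeak // [z == x]eq_sym [w == y]eq_sym.
Qed.

End PeakCoalgebra.

Theorem theorem2 (K : fieldType) (charK : [pchar K] =i pred0) :
  (* the orthogonal space of the peak algebra is the kernel of theta *)
  peak_perp K = ker_theta K /\
  (* the peak algebra is a sub-coalgebra of the descent algebra *)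
  (peak_algebra K `<=` descent_algebra K /\
   forall phi : perms -> K^o,
     peak_algebra K phi -> peak_algebra2 K (coprod phi)) /\
  (* the Stembridge peak algebra is closed under products *)
  (forall f g : series K, stembridge_algebra K f -> stembridge_algebra K g ->
     stembridge_algebra K (series_mul f g)) /\
  (* the pairing is well defined: bilinear, with the prescribed values *)
  ((forall (a : K) (phi psi : perms -> K^o) (f : series K),
      peak_algebra K phi -> peak_algebra K psi -> stembridge_algebra K f ->
      ppair (a *: phi + psi) f = a * ppair phi f + ppair psi f) /\
   (forall (a : K) (phi : perms -> K^o) (f g : series K),
      peak_algebra K phi -> stembridge_algebra K f -> stembridge_algebra K g ->
      ppair phi (a *: f + g) = a * ppair phi f + ppair phi g) /\
   (forall (n m : nat) (P Q : {fset nat}), peak_set n P -> peak_set m Q ->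
      ppair (Pi K (n, P)) (Kst K (m, Q)) = ((n == m) && (P == Q))%:R)) /\
  (* duality: the pairing is non-degenerate on both sides *)
  ((forall phi : perms -> K^o, peak_algebra K phi ->
      (forall f : series K, stembridge_algebra K f -> ppair phi f = 0) ->
      phi = 0) /\
   (forall f : series K, stembridge_algebra K f ->
      (forall phi : perms -> K^o, peak_algebra K phi -> ppair phi f = 0) ->
      f = 0)) /\
  (* compatibility of the product and the coproduct *)
  (forall (phi psi : perms -> K^o) (f g : series K),
     peak_algebra K phi -> peak_algebra K psi ->
     stembridge_algebra K f -> stembridge_algebra K g ->
     ppair2 (tens phi psi) (tens f g) = ppair phi f * ppair psi g) /\
  (forall (phi : perms -> K^o) (f g : series K),
     peak_algebra K phi -> stembridge_algebra K f -> stembridge_algebra K g ->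
     ppair phi (series_mul f g) = ppair2 (coprod phi) (tens f g)).
Proof.
have Pi_in x : peak_set x.1 x.2 -> peak_algebra K (Pi K x).
  exact: (@span_basis _ _ _ peak_sets).
have Kst_in x : peak_set x.1 x.2 -> stembridge_algebra K (Kst K x).
  exact: (@span_basis _ _ _ peak_sets).
split; first exact: peak_perp_ker_theta.
split; first by split; [exact: peak_descent | exact: coprod_peak].
split; first exact: stembridge_mul.
split.
  split; first by move=> a phi psi f Pphi Ppsi _; apply: ppair_linearl.
  split; first by move=> a phi f g Pphi Sf Sg; apply: (ppair_linearr charK Pphi).
  by move=> n m P Q pP pQ; rewrite (@ppair_basis K charK (n, P) (m, Q)).
split; first by split; [exact: ppair_nondegl | exact: ppair_nondegr].
by split; [exact: ppair2_tens | exact: ppair_mul].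
Qed.
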